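(* For every $E,B\ge0$, every $m\in\mathbb{N}$ and every $f\in\operatorname{Ran}\mathbf{1}_{(-\infty,E]}(H_B)$, the magnetic Bernstein inequality $$\sum_{\alpha\in\{1,2\}^m}\lVert\tilde\partial_{\alpha_1}\tilde\partial_{\alpha_2}\cdots\tilde\partial_{\alpha_m}f\rVert_{L^2(\mathbb{R}^2)}^2\le C_B(m)\lVert f\rVert_{L^2(\mathbb{R}^2)}^2$$ holds, where $C_B(m)=(E+Bm)^m$.
   Context: The magnetic derivatives at field strength $B$ are $\tilde\partial_1=i\partial_1-\frac B2x_2$, $\tilde\partial_2=i\partial_2+\frac B2x_1$. The Landau operator is $H_B=\tilde\partial_1^2+\tilde\partial_2^2$, a self-adjoint operator in $L^2(\mathbb{R}^2)$ with operator core $C_0^\infty(\mathbb{R}^2)$; for $B>0$ its spectrum is $\{B,3B,5B,\dots\}$, and for $B=0$ it is $-\Delta$. $\mathbf{1}_{(-\infty,E]}(H_B)$ is the spectral projector onto energies up to $E$, and $\operatorname{Ran}$ denotes the range. *)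

(* Defs.v *)
From HB Require Import structures.
From mathcomp Require Import all_boot all_order all_algebra.
From mathcomp Require Import all_classical all_reals all_analysis.
From mathcomp Require Import complex.

Set Implicit Arguments.
Unset Strict Implicit.
Unset Printing Implicit Defensive.

Import Order.TTheory GRing.Theory Num.Theory.
Import numFieldNormedType.Exports.

Local Open Scope classical_set_scope.
Local Open Scope ring_scope.
Local Open Scope complex_scope.

Section L2.
Context {R : realType}.
Implicit Types f g h : R * R -> R[i].

Local Notation plane := (measurableTypeR R * measurableTypeR R)%type.

Definition leb2 : {measure set plane -> \bar R} :=
  (@lebesgue_measure R \x @lebesgue_measure R)%E.

Definition L2norm f : \bar R :=
  Lnorm leb2 2%:E (fun x => (ComplexField.Normc.normc (f x))%:E).

(* Elements of L^2(R^2; C) are handled through representatives: "equal in L^2"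
   means equal almost everywhere. *)
Definition L2 f : Prop :=
  [/\ measurable_fun setT ((fun x => complex.Re (f x)) : plane -> R),
      measurable_fun setT ((fun x => complex.Im (f x)) : plane -> R) &
      (L2norm f < +oo)%E].

Definition eqL2 f g : Prop := {ae leb2, forall x, f x = g x}.

(* Linear in the first argument, antilinear in the second one. *)
Definition inner f g : R[i] :=
  Rintegral leb2 setT (fun x => complex.Re (f x * conjc (g x)))
  +i* Rintegral leb2 setT (fun x => complex.Im (f x * conjc (g x))).

Definition L2cvg (u : nat -> R * R -> R[i]) f : Prop :=
  L2norm (fun x => u n x - f x) @[n --> \oo] --> 0%E.

Record orthogonal_projection (Q : (R * R -> R[i]) -> (R * R -> R[i])) : Prop :=
  OrthogonalProjection {
    oproj_L2 : forall f, L2 f -> L2 (Q f) ;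
    oproj_eq : forall f g, L2 f -> L2 g -> eqL2 f g -> eqL2 (Q f) (Q g) ;
    oproj_linear : forall (c : R[i]) f g, L2 f -> L2 g ->
      eqL2 (Q (fun x => c * f x + g x)) (fun x => c * Q f x + Q g x) ;
    oproj_idem : forall f, L2 f -> eqL2 (Q (Q f)) (Q f) ;
    oproj_sym : forall f g, L2 f -> L2 g -> inner (Q f) g = inner f (Q g) }.

Record projection_valued_measure
    (P : set (measurableTypeR R) -> (R * R -> R[i]) -> (R * R -> R[i])) : Prop :=
  ProjectionValuedMeasure {
    pvm_proj : forall S, measurable S -> orthogonal_projection (P S) ;
    pvm_setT : forall f, L2 f -> eqL2 (P setT f) f ;
    pvm_setI : forall S1 S2 f, measurable S1 -> measurable S2 -> L2 f ->
      eqL2 (P (S1 `&` S2) f) (P S1 (P S2 f)) ;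
    (* Countable additivity, in the weak form (which for projections is
       equivalent to the strong one): S |-> <P S f, f> is a measure. *)
    pvm_sigma_additive : forall f, L2 f ->
      exists nu : {measure set (measurableTypeR R) -> \bar R},
        forall S, measurable S -> nu S = (complex.Re (inner (P S f) f))%:E }.

(* P is the spectral measure of the operator with graph T, that is
   T = \int lambda dP(lambda):
   f is in the domain of T iff \int lambda^2 d<P f, f> < +oo, and then
   <T f, f> = \int lambda d<P f, f>, which determines T by polarization.
   Such a P exists iff T is selfadjoint, and it is then unique. *)
Definition spectral_measure_of (T : (R * R -> R[i]) -> (R * R -> R[i]) -> Prop)
    (P : set (measurableTypeR R) -> (R * R -> R[i]) -> (R * R -> R[i])) : Prop :=
  projection_valued_measure P /\
  forall (f : R * R -> R[i]) (nu : {measure set (measurableTypeR R) -> \bar R}),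
    L2 f ->
    (forall S, measurable S -> nu S = (complex.Re (inner (P S f) f))%:E) ->
    ((exists g, T f g) <-> (\int[nu]_x (x ^+ 2)%:E < +oo)%E) /\
    (forall g, T f g -> inner g f = (Rintegral nu setT id)%:C).

(* f belongs to Ran 1_S(T). *)
Definition ran_spectral_projector
    (T : (R * R -> R[i]) -> (R * R -> R[i]) -> Prop)
    (S : set (measurableTypeR R)) f : Prop :=
  exists P, spectral_measure_of T P /\
    L2 f /\ exists h, L2 h /\ eqL2 f (P S h).

End L2.

Section Magnetic.
Context {R : realType}.
Implicit Types (B : R) (j : 'I_2) (f g phi : R * R -> R[i]).

(* The coordinate indices 1, 2 are represented by 0, 1 : 'I_2. *)
Definition partial j (u : R * R -> R) : R * R -> R :=
  fun x => 'D_(if j == 0 then (1, 0) else (0, 1) : R * R) u x.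

Definition partialC j f : R * R -> R[i] :=
  fun x => partial j (fun y => complex.Re (f y)) x
           +i* partial j (fun y => complex.Im (f y)) x.

Definition smooth (u : R * R -> R) : Prop :=
  forall (s : seq 'I_2) (x : R * R), differentiable (foldr partial u s) x.

(* The space C_0^oo(R^2). *)
Definition test_function phi : Prop :=
  [/\ smooth (fun x => complex.Re (phi x)),
      smooth (fun x => complex.Im (phi x)) &
      compact (closure [set x | phi x != 0])].

Definition mder B j f : R * R -> R[i] := fun x =>
  if j == 0 then (0 +i* 1) * partialC j f x - (B / 2 * x.2)%:C * f x
            else (0 +i* 1) * partialC j f x + (B / 2 * x.1)%:C * f x.

Definition mder_word B (s : seq 'I_2) f : R * R -> R[i] := foldr (mder B) f s.

(* g represents the distribution obtained by applying the magnetic derivatives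
   s_1 s_2 ... s_m to f. Each of them is formally symmetric, so that they reach
   the test function in reverse order. *)
Definition weak_mder_word B (s : seq 'I_2) f g : Prop :=
  forall phi, test_function phi -> inner g phi = inner f (mder_word B (rev s) phi).

Definition landau_test B phi : R * R -> R[i] := fun x =>
  mder B 0 (mder B 0 phi) x + mder B 1 (mder B 1 phi) x.

(* Graph of H_B: since C_0^oo(R^2) is an operator core, H_B is the closure of
   its restriction to test functions. *)
Definition landau B f g : Prop :=
  [/\ L2 f, L2 g &
      exists phi : nat -> R * R -> R[i],
        [/\ forall n, test_function (phi n),
            L2cvg phi f &
            L2cvg (fun n => landau_test B (phi n)) g]].

End Magnetic.

(* Main.v *)
(* With D_1, D_2 the magnetic derivatives and a = D_1 + i D_2, a* = D_1 - i D_2,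
   one has a* a = H - B, a a* = H + B and H a = a (H - 2 B).  Hence a and a* map
   functions of energy at most E to functions of energy at most E + B and
   E + 2 B, with |a f|^2 <= (E - B) |f|^2 and |a* f|^2 <= (E + B) |f|^2, and the
   parallelogram law |D_1 f|^2 + |D_2 f|^2 = (|a f|^2 + |a* f|^2) / 2 gives the
   bound by induction on m, since (M - m B) (M + B)^m <= M^(m + 1).

   "Energy at most K" is expressed by the growth |H^n f| <= C K^n, which passes
   from f to a f and a* f.  For this, a f has to be in the domain of H: as it
   satisfies H (a f) = a (H - 2 B) f weakly, selfadjointness of H suffices, and
   this follows from the existence of a spectral measure P by cutting off with
   P [-n, n].  L^2 functions are treated as a real vector space with the
   semi-inner product Re <f, g>. *)
From HB Require Import structures.
Require Import Defs.
From mathcomp Require Import all_boot all_order all_algebra.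
From mathcomp Require Import all_classical all_reals all_analysis.
From mathcomp Require Import complex measurable_realfun ring lra.
Set Implicit Arguments.
Unset Strict Implicit.
Unset Printing Implicit Defensive.
Import Order.TTheory GRing.Theory Num.Theory.
Import numFieldNormedType.Exports.
Local Open Scope classical_set_scope.
Local Open Scope ring_scope.

(** * Semi-inner product spaces *)

(** The hypothesis tells which vectors lie in the domain of T and gives the diagonal form <T f, f>,
    nothing more. That T commutes with its spectral projections, and every bound on |T f|, has to be
    extracted from quadratic forms by polarization.

    Growth rates control |H| rather than H. The orbit of a f is a (H - 2 B)^n f, so H - 2 B must be
    bounded from both sides: above by E - 2 B, below by -B because H >= B. The rate E + B covers
    both, and it is exactly what the induction tolerates: with M = E + (m + 1) B, the branch of a
    contributes (E - B) M^m, and the branch of a* contributes (E + B) (M + B)^m, where E + B = M - m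
    B.

    The vector a f is obtained as the limit of a phi_n for test functions phi_n that approximate f
    in the graph norm of H; hence the need for completeness of L^2. *)

Section SemiInner.
Context {R : realType} {V : lmodType R}.

(** Definiteness is left out because functions that agree almost everywhere are not identified.
    Equality of vectors is tested against all vectors instead, and [ip_null] stands in for
    definiteness. *)
Record semi_inner (ip : V -> V -> R) : Prop := SemiInner {
  ipC : forall u v, ip u v = ip v u ;
  ipDl : forall u v w, ip (u + v) w = ip u w + ip v w ;
  ipZl : forall c u w, ip (c *: u) w = c * ip u w ;
  ip_ge0 : forall u, 0 <= ip u u }.

Context {ip : V -> V -> R} (hip : semi_inner ip).

Lemma ipDr w u v : ip w (u + v) = ip w u + ip w v.
Proof. by rewrite (ipC hip) (ipDl hip) !(ipC hip _ w). Qed.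
Lemma ipZr c w u : ip w (c *: u) = c * ip w u.
Proof. by rewrite (ipC hip) (ipZl hip) (ipC hip u). Qed.
Lemma ipNl u w : ip (- u) w = - ip u w.
Proof. by rewrite -scaleN1r (ipZl hip) mulN1r. Qed.
Lemma ipNr w u : ip w (- u) = - ip w u.
Proof. by rewrite -scaleN1r ipZr mulN1r. Qed.
Lemma ip0l w : ip 0 w = 0.
Proof. by rewrite -(scale0r (0 : V)) (ipZl hip) mul0r. Qed.
Lemma ip0r w : ip w 0 = 0.
Proof. by rewrite -(scale0r (0 : V)) ipZr mul0r. Qed.

Definition ipE := (ipDl hip, ipDr, ipZl hip, ipZr, ipNl, ipNr, ip0l, ip0r).

Lemma ip_CS u v : ip u v ^+ 2 <= ip u u * ip v v.
Proof.
have quad t : 0 <= ip u u + t * 2 * ip u v + t ^+ 2 * ip v v.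
  have := ip_ge0 hip (u + t *: v); rewrite !ipE (ipC hip v u).
  by rewrite (_ : _ + _ = ip u u + t * 2 * ip u v + t ^+ 2 * ip v v) //; ring.
have := ip_ge0 hip v; rewrite le_eqVlt => /predU1P[v0|v0].
  rewrite -v0 mulr0; have [->|uv0] := eqVneq (ip u v) 0; first by rewrite expr0n.
  (* With |v| = 0 the polynomial is affine in t; this t gives it the value -1. *)
  have := quad (- (ip u u + 1) / (2 * ip u v)); rewrite -v0 mulr0 addr0.
  by rewrite (_ : _ + _ = -1) ?ler0N1 //; field.
have := quad (- ip u v / ip v v).
rewrite (_ : _ + _ + _ = (ip u u * ip v v - ip u v ^+ 2) / ip v v); last first.
  by field; rewrite gt_eqF.
by rewrite pmulr_lge0 ?invr_gt0 // subr_ge0.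
Qed.

Lemma ip_null u v : ip u u = 0 -> ip u v = 0.
Proof.
move=> u0; have := ip_CS u v; rewrite u0 mul0r => h.
by apply/eqP; rewrite -sqrf_eq0 eq_le h sqr_ge0.
Qed.

Lemma n2D u v : ip (u + v) (u + v) <= 2 * ip u u + 2 * ip v v.
Proof.
have := ip_ge0 hip (u - v); rewrite !ipE (ipC hip v u); lra.
Qed.

Definition vlim (u : nat -> V) (l : V) : Prop :=
  (fun n => ip (u n - l) (u n - l)) @ \oo --> (0 : R).

Lemma vlimP u l :
  vlim u l <-> forall e, 0 < e -> \forall n \near \oo, ip (u n - l) (u n - l) < e.
Proof.
split=> [/cvgrPdist_lt h e e0|h].
  near=> n; have : `|0 - ip (u n - l) (u n - l)| < e by near: n; exact: h.
  by rewrite sub0r normrN ger0_norm // ip_ge0.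
apply/cvgrPdist_lt => e e0; near=> n.
by rewrite sub0r normrN ger0_norm ?ip_ge0 //; near: n; exact: h.
Unshelve. all: by end_near. Qed.

Lemma vlim_cst l : vlim (fun=> l) l.
Proof. by apply/vlimP => e e0; near=> n; rewrite subrr ip0l. Unshelve. all: by end_near. Qed.

Lemma vlimD u v l m : vlim u l -> vlim v m -> vlim (fun n => u n + v n) (l + m).
Proof.
move=> /vlimP hu /vlimP hv; apply/vlimP => e e0.
have e4 : 0 < e / 4 by lra.
near=> n.
have h1 : ip (u n - l) (u n - l) < e / 4 by near: n; exact: hu.
have h2 : ip (v n - m) (v n - m) < e / 4 by near: n; exact: hv.
have -> : u n + v n - (l + m) = (u n - l) + (v n - m) by rewrite opprD addrACA.
have := n2D (u n - l) (v n - m); lra.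
Unshelve. all: by end_near. Qed.

Lemma vlimZ c u l : vlim u l -> vlim (fun n => c *: u n) (c *: l).
Proof.
rewrite /vlim => hu.
rewrite (_ : (fun _ => _) = (fun n => c ^+ 2 * ip (u n - l) (u n - l))).
  by rewrite -(mulr0 (c ^+ 2)); apply: cvgM => //; exact: cvg_cst.
by apply/funext => n; rewrite -scalerBr (ipZl hip) ipZr mulrA.
Qed.

Lemma ip_vlim u l w : vlim u l -> (fun n => ip (u n) w) @ \oo --> ip l w.
Proof.
move=> /vlimP hu; apply/cvgrPdist_lt => e e0.
have w0 : 0 < ip w w + 1 by rewrite ltr_pwDr // ip_ge0.
near=> n.
have h : ip (u n - l) (u n - l) < e ^+ 2 / (ip w w + 1).
  by near: n; apply: hu; rewrite divr_gt0 // exprn_gt0.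
rewrite -(@ltr_pXn2r _ 2) ?nnegrE ?normr_ge0 ?(ltW e0) // real_normK ?num_real //.
have -> : ip l w - ip (u n) w = - ip (u n - l) w by rewrite !ipE; ring.
rewrite sqrrN; apply: (le_lt_trans (ip_CS _ _)).
move: h; rewrite ltr_pdivlMr // => h; apply: le_lt_trans h.
by rewrite ler_wpM2l ?ip_ge0 // lerDl.
Unshelve. all: by end_near. Qed.

Lemma n2_vlim u l : vlim u l -> (fun n => ip (u n) (u n)) @ \oo --> ip l l.
Proof.
move=> hu.
have -> : ip l l = 0 + 2 * ip l l - ip l l by ring.
rewrite (_ : (fun _ => _) =
  (fun n => ip (u n - l) (u n - l) + 2 * ip (u n) l - ip l l)); last first.
  by apply/funext => n; rewrite !ipE (ipC hip l (u n)); ring.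
apply: cvgB; last exact: cvg_cst.
by apply: cvgD => //; apply: cvgM; [exact: cvg_cst|exact: ip_vlim].
Qed.

(** Polarization reduces the joint limit to limits of squared norms. *)
Lemma ip_vlim2 u v l m : vlim u l -> vlim v m ->
  (fun n => ip (u n) (v n)) @ \oo --> ip l m.
Proof.
move=> hu hv.
have -> : ip l m = 2^-1 * (ip (l + m) (l + m) - ip l l - ip m m).
  by rewrite !ipE (ipC hip m l); field.
rewrite (_ : (fun _ => _) = (fun n => 2^-1 * (ip (u n + v n) (u n + v n)
   - ip (u n) (u n) - ip (v n) (v n)))); last first.
  by apply/funext => n; rewrite !ipE (ipC hip (v n) (u n)); field.
apply: cvgM; first exact: cvg_cst.
by apply: cvgB; [apply: cvgB|]; apply: n2_vlim => //; exact: vlimD.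
Qed.

(** Limits are determined only up to null vectors. This lets a closed graph absorb a change of
    representatives, see [graph_null]. *)
Lemma vlim_shift u l v : vlim u l -> ip (l - v) (l - v) = 0 -> vlim u v.
Proof.
move=> hu lv; rewrite /vlim.
rewrite (_ : (fun _ => _) = (fun n => ip (u n - l) (u n - l))) //.
apply/funext => n.
have -> : u n - v = (u n - l) + (l - v) by rewrite addrA subrK.
move: (u n - l) (l - v) lv => a b b0.
by rewrite !ipE (ipC hip a b) !(ip_null _ b0) !addr0.
Qed.

Lemma ip_eq0 u : (forall w, ip u w = 0) -> ip u u = 0.
Proof. by move=> ->. Qed.

Lemma vlim_cauchy u l : vlim u l -> forall e, 0 < e -> exists N, forall p q,
  (N <= p)%N -> (N <= q)%N -> ip (u p - u q) (u p - u q) < e.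
Proof.
move=> /vlimP hu e e0; have e4 : 0 < e / 4 by lra.
have [N _ hN] := hu _ e4; exists N => p q /hN /= h1 /hN /= h2.
have -> : u p - u q = (u p - l) + (-1) *: (u q - l).
  by rewrite scaleN1r opprB addrA subrK.
have := n2D (u p - l) (-1 *: (u q - l)); rewrite (ipZl hip (-1)) ipZr; lra.
Qed.

End SemiInner.
Arguments vlim {R V} ip u l.

Definition ip_complete {R : realType} {V : lmodType R} (ip : V -> V -> R) :=
  forall u : nat -> V,
    (forall e, 0 < e -> exists N, forall p q,
      (N <= p)%N -> (N <= q)%N -> ip (u p - u q) (u p - u q) < e) ->
    exists l, vlim ip u l.

(** * Symmetric operators as graphs, and growth of their orbits *)

Section Graph.
Context {R : realType} {V : lmodType R}.

Definition closed_graph (ip : V -> V -> R) (T : V -> V -> Prop) : Prop :=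
  forall u v f g, (forall n, T (u n) (v n)) ->
    vlim ip u f -> vlim ip v g -> T f g.

Record symmetric_graph (ip : V -> V -> R) (T : V -> V -> Prop) : Prop :=
  SymmetricGraph {
    graphD : forall f g f' g', T f g -> T f' g' -> T (f + f') (g + g') ;
    graphZ : forall c f g, T f g -> T (c *: f) (c *: g) ;
    graph_sym : forall f g f' g', T f g -> T f' g' -> ip g f' = ip f g' }.

(* Ran 1_(-oo,K](T) for a nonnegative selfadjoint T, without spectral measure:
   the orbit f, T f, T (T f), ... grows like K ^ n. *)
Definition bandlimited (ip : V -> V -> R) (T : V -> V -> Prop) (K : R) (f : V) :=
  exists u : nat -> V, [/\ u 0%N = f, forall n, T (u n) (u n.+1) &
    exists C, forall n, ip (u n) (u n) <= C * (K ^+ 2) ^+ n].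

Context {ip : V -> V -> R} (hip : semi_inner ip).
Context {T : V -> V -> Prop} (hT : symmetric_graph ip T).

Lemma bandlimited_comb K c f g : bandlimited ip T K f -> bandlimited ip T K g ->
  bandlimited ip T K (f + c *: g).
Proof.
move=> [u [<- Tu [C hC]]] [v [<- Tv [C' hC']]].
exists (fun n => u n + c *: v n); split => //.
  by move=> n; apply: (graphD hT) => //; exact: (graphZ hT).
exists (2 * C + 2 * c ^+ 2 * C') => n.
apply: (le_trans (n2D hip _ _)); rewrite (ipZl hip) (ipZr hip).
have := ler_wpM2l (sqr_ge0 c) (hC' n); have := hC n.
move: (ip (u n) _) (ip (v n) _) (_ ^+ n) => a b X; lra.
Qed.

(* n |-> n2 (u n) is log-convex along an orbit, so a step cannot grow faster
   than the asymptotic rate. *)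
Lemma orbit_step_norm K C (u : nat -> V) : 0 <= K ->
  (forall n, T (u n) (u n.+1)) ->
  (forall n, ip (u n) (u n) <= C * (K ^+ 2) ^+ n) ->
  ip (u 1%N) (u 1%N) <= K ^+ 2 * ip (u 0%N) (u 0%N).
Proof.
move=> K0 Tu hC; rewrite leNgt; apply/negP => big.
pose r n := ip (u n) (u n).
have r0 n : 0 <= r n by exact: (ip_ge0 hip).
(* <u_(n+1), u_(n+1)> = <T u_n, u_(n+1)> = <u_n, u_(n+2)> by symmetry, then Cauchy-Schwarz. *)
have conv n : r n.+1 ^+ 2 <= r n * r n.+2.
  rewrite /r [X in X ^+ 2 <= _](graph_sym hT (Tu n) (Tu n.+1)).
  exact: (ip_CS hip).
have r00 : 0 < r 0%N.
  rewrite lt_neqAle r0 andbT; apply/eqP => z.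
  have := conv 0%N; rewrite -z mul0r => h.
  have : r 1%N = 0 by apply/eqP; rewrite -sqrf_eq0 eq_le h sqr_ge0.
  by move: big; rewrite -!/(r _) -z mulr0 => /[swap] ->; rewrite ltxx.
(* By convexity every later ratio is at least the first one, so r(n) >= rho^n r(0). With rho > K^2
   this outgrows C K^(2 n). *)
pose rho := r 1%N / r 0%N.
have rhoK : K ^+ 2 < rho by rewrite ltr_pdivlMr.
have rho0 : 0 < rho by apply: le_lt_trans rhoK; rewrite sqr_ge0.
have step n : 0 < r n /\ rho * r n <= r n.+1.
  elim: n => [|n [rn IH]]; first by split => //; rewrite divfK ?gt_eqF.
  have rn1 : 0 < r n.+1 by apply: lt_le_trans IH; rewrite mulr_gt0.
  split => //.
  rewrite -(ler_pM2r rn); apply: le_trans (_ : r n.+1 ^+ 2 <= _); last first.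
    by rewrite mulrC conv.
  by rewrite expr2 mulrAC ler_pM2r.
have low n : rho ^+ n * r 0%N <= r n.
  elim: n => [|n IH]; first by rewrite expr0 mul1r.
  apply: le_trans (step n).2; rewrite exprS -mulrA ler_pM2l //.
have : forall n, (rho) ^+ n * r 0%N <= C * (K ^+ 2) ^+ n.
  by move=> n; exact: le_trans (low n) (hC n).
have [K2|K2] := eqVneq (K ^+ 2) 0.
  move=> /(_ 1%N); rewrite K2 expr0n mulr0 expr1 leNgt.
  by rewrite mulr_gt0.
have K20 : 0 < K ^+ 2 by rewrite lt_neqAle eq_sym K2 sqr_ge0.
pose q := K ^+ 2 / rho.
have q1 : q < 1 by rewrite ltr_pdivrMr ?mul1r.
have q0 : 0 < q by rewrite divr_gt0.
move=> hq.
have bd n : r 0%N <= C * q ^+ n.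
  rewrite expr_div_n mulrA ler_pdivlMr ?exprn_gt0 // mulrC; exact: hq.
have : (fun n => C * q ^+ n) @ \oo --> C * 0.
  apply: cvgM; first exact: cvg_cst.
  by apply: cvg_expr; rewrite ger0_norm // ltW.
rewrite mulr0 => /cvgrPdist_lt /(_ _ r00) [N _ /(_ N (leqnn N))] /=.
rewrite sub0r normrN => h; have := le_lt_trans (ler_norm _) h.
by rewrite ltNge bd.
Qed.

Lemma bandlimited_step K f : 0 <= K -> bandlimited ip T K f ->
  exists g, [/\ T f g, bandlimited ip T K g & ip g g <= K ^+ 2 * ip f f].
Proof.
move=> K0 [u [<- Tu [C hC]]]; exists (u 1%N); split; first exact: Tu.
  exists (fun n => u n.+1); split => //; exists (C * K ^+ 2) => n.
  by rewrite -mulrA -exprS.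
exact: orbit_step_norm Tu hC.
Qed.

(** Cauchy-Schwarz and |T f| <= K |f|. The orbit supplies some image h of f, possibly different from
    g; symmetry turns <g, f> into <f, h>. *)
Lemma bandlimited_form K f g : 0 <= K -> bandlimited ip T K f -> T f g ->
  ip g f <= K * ip f f.
Proof.
move=> K0 /(bandlimited_step K0)[h [Tfh _ hh]] Tfg.
rewrite (graph_sym hT Tfg Tfh).
have Kf : 0 <= K * ip f f by rewrite mulr_ge0 // ip_ge0.
have := le_trans (ip_CS hip f h) (ler_wpM2l (ip_ge0 hip f) hh).
move=> sq; rewrite leNgt; apply/negP => lt.
have : (K * ip f f) ^+ 2 < ip f h ^+ 2.
  by rewrite ltr_pXn2r ?nnegrE // ltW // (le_lt_trans Kf).
rewrite ltNge; apply/negP; rewrite negbK; apply: (le_trans sq).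
by rewrite exprMn [ip f f ^+ 2]expr2 mulrCA.
Qed.

(* With h = T f - c f, the difference of the quadratic forms of T - c at f + t h
   and at f - t h is 4 t |h|^2. *)
Lemma invariant_shift_norm (W : V -> Prop) (c L : R) f :
  0 <= L ->
  (forall t u v, W u -> W v -> W (u + t *: v)) ->
  (forall u, W u -> exists2 v, T u v & W v) ->
  (forall u v, W u -> T u v -> (c - L) * ip u u <= ip v u <= (c + L) * ip u u) ->
  W f -> exists g, [/\ T f g, W (g - c *: f) &
    ip (g - c *: f) (g - c *: f) <= L ^+ 2 * ip f f].
Proof.
move=> L0 WD Wstep bnd Wf.
have [g Tfg Wg] := Wstep _ Wf.
exists g; split => //.
  by rewrite -scaleNr; exact: WD.
have [h hE] : exists h, h = g - c *: f by exists (g - c *: f).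
rewrite -hE; have Wh : W h by rewrite hE -scaleNr; exact: WD.
have [k Thk _] := Wstep _ Wh.
(* Upper bound at f + t h combined with the lower bound at f - t h; on the right the parallelogram
   law leaves 2 L (|f|^2 + t^2 |h|^2). *)
have quad t : 4 * t * ip h h <= 2 * L * (ip f f + t ^+ 2 * ip h h).
  have Tt s : T (f + s *: h) (g + s *: k).
    by apply: (graphD hT) => //; exact: (graphZ hT).
  have Wt s : W (f + s *: h) by exact: WD.
  have /andP[_ up] := bnd _ _ (Wt t) (Tt t).
  have /andP[lo _] := bnd _ _ (Wt (- t)) (Tt (- t)).
  have kf : ip k f = ip h g by exact: (graph_sym hT Thk Tfg).
  have hg : ip h g = ip h h + c * ip h f.
    by rewrite -[g in LHS](subrK (c *: f)) -hE !(ipE hip).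
  have gh : ip g h = ip h h + c * ip h f by rewrite (ipC hip).
  move: lo up; rewrite !(ipE hip) kf hg gh (ipC hip f h) /=.
  lra.
move: L0; rewrite le_eqVlt => /predU1P[L0|L0].
  by have := quad 1; rewrite -L0; lra.
(* The choice t = 1 / L gives 4 |h|^2 <= 2 L^2 |f|^2 + 2 |h|^2. *)
have := quad L^-1.
rewrite -(ler_pM2l L0) => q.
have e1 : L * (4 / L * ip h h) = 4 * ip h h by field; rewrite gt_eqF.
have e2 : L * (2 * L * (ip f f + L^-1 ^+ 2 * ip h h)) = 2 * L ^+ 2 * ip f f + 2 * ip h h.
  by field; rewrite gt_eqF.
move: q; rewrite e1 e2; lra.
Qed.

(** Serves to iterate T - c with c = 2 s B, the shift that appears when a ladder operator passes T.
    The growth rate already gives the upper half of the two-sided form bound; only the lower half is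
    assumed. *)
Lemma bandlimited_shift_norm K c L f : 0 <= K -> 0 <= L -> K - c <= L ->
  (forall u v, bandlimited ip T K u -> T u v -> (c - L) * ip u u <= ip v u) ->
  bandlimited ip T K f ->
  exists g, [/\ T f g, bandlimited ip T K (g - c *: f) &
    ip (g - c *: f) (g - c *: f) <= L ^+ 2 * ip f f].
Proof.
move=> K0 L0 KL low; apply: invariant_shift_norm => //.
- by move=> t u v; exact: bandlimited_comb.
- by move=> u /(bandlimited_step K0)[v [Tuv Wv _]]; exists v.
move=> u v Wu Tuv; rewrite low //=; apply: le_trans (bandlimited_form K0 Wu Tuv) _.
by rewrite ler_wpM2r ?(ip_ge0 hip) //; lra.
Qed.
End Graph.

(** * Ladder operators *)

Section MagneticAlgebra.
Context {R : realType} {V : lmodType R}.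

(** [J] is multiplication by i on a complex space regarded as a real one, so that complex linearity
    becomes commutation with [J]. *)
Record test_space (ip : V -> V -> R) (J : V -> V) (tst : V -> Prop) : Prop :=
  TestSpace {
    JD : forall u v, J (u + v) = J u + J v ;
    JZ : forall c u, J (c *: u) = c *: J u ;
    JJ : forall u, J (J u) = - u ;
    ipJ : forall u v, ip (J u) (J v) = ip u v ;
    tstD : forall u v, tst u -> tst v -> tst (u + v) ;
    tstZ : forall c u, tst u -> tst (c *: u) ;
    tstJ : forall u, tst u -> tst (J u) }.

(** All requirements concern test vectors: on other vectors the concrete derivatives may take
    default values. *)
Record symmetric_operator (ip : V -> V -> R) (J : V -> V) (tst : V -> Prop)
    (D : V -> V) : Prop := SymmetricOperator {
  tst_op : forall u, tst u -> tst (D u) ;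
  opD : forall u v, tst u -> tst v -> D (u + v) = D u + D v ;
  opZ : forall c u, tst u -> D (c *: u) = c *: D u ;
  opJ : forall u, tst u -> D (J u) = J (D u) ;
  op_sym : forall u v, tst u -> tst v -> ip (D u) v = ip u (D v) }.

Definition landau_op (D0 D1 : V -> V) (u : V) : V := D0 (D0 u) + D1 (D1 u).

Definition landau_graph (ip : V -> V -> R) (tst : V -> Prop) (D0 D1 : V -> V)
    (f g : V) : Prop :=
  exists phi : nat -> V, [/\ forall n, tst (phi n), vlim ip phi f &
    vlim ip (fun n => landau_op D0 D1 (phi n)) g].

(* s = 1 gives the annihilation operator, s = -1 the creation operator. *)
Definition ladder_op (J : V -> V) (D0 D1 : V -> V) (s : R) (u : V) : V :=
  D0 u + s *: J (D1 u).

Context {ip : V -> V -> R} (hip : semi_inner ip).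
Context {B : R} {J : V -> V} {tst : V -> Prop} {D0 D1 : V -> V}.
Context (hm : test_space ip J tst) (hD0 : symmetric_operator ip J tst D0)
  (hD1 : symmetric_operator ip J tst D1)
  (comm : forall u, tst u -> D0 (D1 u) = D1 (D0 u) + B *: J u).

Local Notation H := (landau_op D0 D1).
Local Notation T := (landau_graph ip tst D0 D1).
Local Notation ladder := (ladder_op J D0 D1).

Lemma ipJl u v : ip (J u) v = - ip u (J v).
Proof. by rewrite -(ipJ hm u) (JJ hm) (ipNr hip) opprK. Qed.

Let t0 := tst_op hD0.
Let t1 := tst_op hD1.

Lemma tst_landau u : tst u -> tst (H u).
Proof. by move=> hu; apply: (tstD hm); [apply/t0/t0|apply/t1/t1]. Qed.

Lemma tst_ladder s u : tst u -> tst (ladder s u).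
Proof.
move=> hu; apply: (tstD hm); first exact: t0.
by apply/(tstZ hm)/(tstJ hm)/t1.
Qed.

Lemma ladderD s u v : tst u -> tst v -> ladder s (u + v) = ladder s u + ladder s v.
Proof.
move=> hu hv; rewrite /ladder_op (opD hD0) // (opD hD1) //.
by rewrite (JD hm) scalerDr addrACA.
Qed.

Lemma ladderZ s c u : tst u -> ladder s (c *: u) = c *: ladder s u.
Proof.
move=> hu; rewrite /ladder_op (opZ hD0) // (opZ hD1) //.
by rewrite (JZ hm) scalerDr !scalerA [s * c]mulrC.
Qed.

Lemma landauD u v : tst u -> tst v -> H (u + v) = H u + H v.
Proof.
move=> hu hv; rewrite /landau_op (opD hD0 hu hv) (opD hD1 hu hv).
by rewrite (opD hD0 (t0 hu) (t0 hv)) (opD hD1 (t1 hu) (t1 hv)) addrACA.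
Qed.

Lemma landauZ c u : tst u -> H (c *: u) = c *: H u.
Proof.
move=> hu; rewrite /landau_op (opZ hD0 _ hu) (opZ hD1 _ hu).
by rewrite (opZ hD0 _ (t0 hu)) (opZ hD1 _ (t1 hu)) scalerDr.
Qed.

Lemma landau_op_sym u v : tst u -> tst v -> ip (H u) v = ip u (H v).
Proof.
move=> hu hv; rewrite /landau_op !(ipE hip).
rewrite (op_sym hD0 (t0 hu) hv) (op_sym hD0 hu (t0 hv)).
by rewrite (op_sym hD1 (t1 hu) hv) (op_sym hD1 hu (t1 hv)).
Qed.

Lemma ladder_adj s u v : tst u -> tst v -> ip (ladder s u) v = ip u (ladder (- s) v).
Proof.
move=> hu hv; rewrite /ladder_op !(ipE hip) (op_sym hD0 hu hv) ipJl.
by rewrite (op_sym hD1 hu (tstJ hm hv)) (opJ hD1 hv) mulrN mulNr.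
Qed.

(** The squares give H, and the cross terms leave s J (D0 D1 - D1 D0) u = s B J (J u) = - s B u. *)
Lemma ladder_ladder s u : s ^+ 2 = 1 -> tst u ->
  ladder (- s) (ladder s u) = H u - (s * B) *: u.
Proof.
move=> s1 hu; have hJ := tstJ hm (t1 hu).
rewrite /ladder_op (opD hD0 (t0 hu) (tstZ hm _ hJ)) (opD hD1 (t0 hu) (tstZ hm _ hJ)).
rewrite (opZ hD0 _ hJ) (opZ hD1 _ hJ) (opJ hD0 (t1 hu)) (opJ hD1 (t1 hu)) comm //.
rewrite !(JD hm, JZ hm, JJ hm) /landau_op.
move: (D0 (D0 u)) (J (D1 (D0 u))) (D1 (D1 u)) => a b c.
rewrite !(scalerDr, scalerA, scalerN, mulrN, mulNr, scaleNr) -expr2 s1 scale1r opprK.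
by rewrite -!addrA; congr (_ + _); rewrite addrCA addNKr addrC.
Qed.

(** Write a for [ladder s] and a' for [ladder (- s)]. Since H = a' a + s B and a a' = H + s B, one
    gets a H = (a a') a + s B a = H a + 2 s B a. *)
Lemma ladder_landau s u : s ^+ 2 = 1 -> tst u ->
  ladder s (H u) = H (ladder s u) + (s * B * 2) *: ladder s u.
Proof.
move=> s1 hu.
have s1' : (- s) ^+ 2 = 1 by rewrite sqrrN.
have hl := tst_ladder.
have e1 : H u = ladder (- s) (ladder s u) + (s * B) *: u.
  by rewrite ladder_ladder // subrK.
have := ladder_ladder s1' (hl s _ hu); rewrite opprK => e2.
rewrite e1 ladderD //; [|exact/hl/hl|exact: (tstZ hm)].
rewrite e2 ladderZ // -addrA; congr (_ + _).
by rewrite -scaleNr -scalerDl; congr (_ *: _); ring.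
Qed.

Lemma landau_graph_test u : tst u -> T u (H u).
Proof. by move=> hu; exists (fun=> u); split => //; exact: vlim_cst. Qed.

Lemma landau_graph_sym : symmetric_graph ip T.
Proof.
split.
- move=> f g f' g' [u [tu uf ug]] [v [tv vf vg]].
  exists (fun n => u n + v n); split; [|exact: vlimD|].
    by move=> n; apply: (tstD hm).
  rewrite (_ : (fun _ => _) = (fun n => H (u n) + H (v n))); first exact: vlimD.
  by apply/funext => n; rewrite landauD.
- move=> c f g [u [tu uf ug]].
  exists (fun n => c *: u n); split; [|exact: vlimZ|].
    by move=> n; apply: (tstZ hm).
  rewrite (_ : (fun _ => _) = (fun n => c *: H (u n))); first exact: vlimZ.
  by apply/funext => n; rewrite landauZ.
- move=> f g f' g' [u [tu uf ug]] [v [tv vf vg]].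
  have h1 := ip_vlim2 hip ug vf; have h2 := ip_vlim2 hip uf vg.
  apply: (cvg_unique _ h1) => //.
  rewrite (_ : (fun n => _) = (fun n => ip (u n) (H (v n)))) //.
  by apply/funext => n; rewrite landau_op_sym.
Qed.

(** Diagonal argument: for each n choose a test vector whose distance to [u n], and whose image's
    distance to [v n], is small; squared distances below 1 / (n + 1) suffice. *)
Lemma landau_graph_closed : closed_graph ip T.
Proof.
move=> u v f g Tuv uf vg.
have ch n : exists p, [/\ tst p, ip (p - u n) (p - u n) < n.+1%:R^-1 &
    ip (H p - v n) (H p - v n) < n.+1%:R^-1].
  have [q [tq qu qv]] := Tuv n.
  have n0 : 0 < n.+1%:R^-1 :> R by rewrite invr_gt0 ltr0n.
  have [N1 _ h1] := (vlimP hip _ _).1 qu _ n0.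
  have [N2 _ h2] := (vlimP hip _ _).1 qv _ n0.
  exists (q (maxn N1 N2)); split => //.
    by apply: h1; rewrite /= leq_maxl.
  by apply: h2; rewrite /= leq_maxr.
have [p hp] := choice ch.
have inv0 : (fun n => n.+1%:R^-1 : R) @ \oo --> (0 : R) by exact: cvg_harmonic.
move/cvgrPdist_lt in inv0.
have aux (w z : nat -> V) l : vlim ip w l ->
    (forall n, ip (z n - w n) (z n - w n) < n.+1%:R^-1) -> vlim ip z l.
  move=> wl zw.
  have zw0 : vlim ip (fun n => z n - w n) 0.
    apply/(vlimP hip) => e e0.
    have [N _ hN] := inv0 _ e0.
    exists N => // n /hN /=; rewrite sub0r normrN subr0 => h.
    by apply: (lt_trans (zw n)); apply: le_lt_trans h; exact: ler_norm.
  have := vlimD hip wl zw0; rewrite addr0.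
  by rewrite (_ : (fun n => w n + (z n - w n)) = z) //; apply/funext => n; rewrite addrC subrK.
exists p; split => [n||].
- by have [] := hp n.
- by apply: (aux u) => // n; have [] := hp n.
- by apply: (aux v) => // n; have [] := hp n.
Qed.

(** The ladder operator in the sense of distributions; by [ladder_adj] the formal adjoint is the one
    with the opposite sign. *)
Definition weak_ladder s f d : Prop := forall psi, tst psi -> ip d psi = ip f (ladder (- s) psi).

(** On test vectors |a p|^2 = <H p, p> - s B |p|^2, so convergence of both p_n and H p_n makes a p_n
    a Cauchy sequence. Its limit d inherits both the weak identity and the norm formula. *)
Lemma weak_ladder_exists (s : R) f g : ip_complete ip -> s ^+ 2 = 1 -> T f g ->
  exists2 d, weak_ladder s f d & ip d d = ip g f - s * B * ip f f.
Proof.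
move=> cpl s1 [u [tu uf ug]].
have nrm p : tst p -> ip (ladder s p) (ladder s p) = ip (H p) p - s * B * ip p p.
  move=> tp; rewrite ladder_adj //; last exact: tst_ladder.
  by rewrite ladder_ladder // (ipDr hip) (ipNr hip) (ipZr hip) (ipC hip p (H p)).
have tB p q : tst p -> tst q -> tst (p - q).
  by move=> tp tq; apply: (tstD hm) => //; rewrite -scaleN1r; exact: (tstZ hm).
have lB p q : tst p -> tst q -> ladder s (p - q) = ladder s p - ladder s q.
  move=> tp tq; rewrite -(scaleN1r q) ladderD //; last exact: (tstZ hm).
  by rewrite ladderZ // scaleN1r.
have HB p q : tst p -> tst q -> H (p - q) = H p - H q.
  move=> tp tq; rewrite -(scaleN1r q) landauD //; last exact: (tstZ hm).
  by rewrite landauZ // scaleN1r.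
have cau : forall e, 0 < e -> exists N, forall p q, (N <= p)%N -> (N <= q)%N ->
    ip (ladder s (u p) - ladder s (u q)) (ladder s (u p) - ladder s (u q)) < e.
  move=> e e0.
  have k0 : 0 < e / 2 / (2 + `|s * B|) by rewrite !divr_gt0 // ltr_wpDr.
  have [N1 h1] := vlim_cauchy hip uf k0.
  have [N2 h2] := vlim_cauchy hip ug k0.
  exists (maxn N1 N2) => p q; rewrite !geq_max => /andP[p1 p2] /andP[q1 q2].
  rewrite -lB // nrm ?HB //; last exact: tB.
  have := h1 _ _ p1 q1; have := h2 _ _ p2 q2.
  set a := H _ - _; set b := u p - u q => aa bb.
  have ab : 2 * ip a b <= ip a a + ip b b.
    by have := ip_ge0 hip (a - b); clearbody a b; rewrite !(ipE hip) (ipC hip b a); lra.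
  have sb : - (s * B) * ip b b <= `|s * B| * ip b b.
    by rewrite ler_wpM2r ?(ip_ge0 hip) // -normrN ler_norm.
  move: aa bb; rewrite !ltr_pdivlMr ?ltr_wpDr // => aa bb.
  have wa : 0 <= `|s * B| * ip a a by rewrite mulr_ge0 // (ip_ge0 hip).
  have := ip_ge0 hip a; have := ip_ge0 hip b.
  lra.
have [d dl] := cpl _ cau.
exists d.
  move=> psi tpsi.
  have h1 := ip_vlim hip (w := psi) dl.
  apply: (cvg_unique _ h1) => //.
  rewrite (_ : (fun n => _) = (fun n => ip (u n) (ladder (- s) psi))).
    exact: (ip_vlim hip).
  by apply/funext => n; rewrite ladder_adj.
have h1 := n2_vlim hip dl.
apply: (cvg_unique _ h1) => //.
rewrite (_ : (fun n => _) = (fun n => ip (H (u n)) (u n) - s * B * ip (u n) (u n))).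
  apply: cvgB; first exact: (ip_vlim2 hip).
  by apply: cvgM; [exact: cvg_cst|exact: (n2_vlim hip)].
by apply/funext => n; rewrite nrm.
Qed.

(** Weak solutions of H f = g already lie in the closure of H on test vectors. For a symmetric H
    this is essential selfadjointness. *)
Definition selfadjoint_graph : Prop :=
  forall f g, (forall psi, tst psi -> ip f (H psi) = ip g psi) -> T f g.

(** The place where the domain problem is settled. Moving everything to the test vector reduces the
    weak identity to [ladder_landau] for - s, and selfadjointness then puts d into the domain. *)
Lemma ladder_intertwine (s : R) f g d e : selfadjoint_graph -> s ^+ 2 = 1 -> T f g ->
  weak_ladder s f d -> weak_ladder s (g - (s * B * 2) *: f) e -> T d e.
Proof.
move=> sa s1 Tfg wd we; apply: sa => psi tpsi.
have s1' : (- s) ^+ 2 = 1 by rewrite sqrrN.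
have tl := tst_ladder (- s) tpsi.
rewrite (wd _ (tst_landau tpsi)) (we _ tpsi) (ladder_landau s1' tpsi) (ipDr hip) (ipZr hip).
rewrite -(graph_sym landau_graph_sym Tfg (landau_graph_test tl)).
rewrite (ipDl hip) (ipNl hip) (ipZl hip) !mulNr; ring.
Qed.

Context (B0 : 0 <= B) (cpl : ip_complete ip) (sa : selfadjoint_graph).

(** For s = 1 the difference of the two sides is the squared norm of the annihilated vector. *)
Lemma landau_lower f g : T f g -> B * ip f f <= ip g f.
Proof.
move=> Tfg; have [|d _ dE] := @weak_ladder_exists 1 f g cpl _ Tfg; first by rewrite expr1n.
by have := ip_ge0 hip d; rewrite dE mul1r subr_ge0.
Qed.

(** L bounds T - 2 s B from both sides: above because K - 2 s B <= L, below because T >= B gives T -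
    2 s B >= - B >= - L. *)
Lemma bandlimited_ladder (K L s : R) f : 0 <= K -> K + B <= L -> K - s * B * 2 <= L ->
  s ^+ 2 = 1 -> bandlimited ip T K f ->
  exists d, [/\ weak_ladder s f d, bandlimited ip T L d &
    ip d d <= (K - s * B) * ip f f].
Proof.
move=> K0 KL KsL s1 Wf.
have sB : s * B <= B.
  have : s <= 1 by nra.
  by move=> /(ler_wpM2r B0); rewrite mul1r.
have L0 : 0 <= L by lra.
have symT := landau_graph_sym.
pose Q (f f' : V) := exists g, [/\ T f g, f' = g - (s * B * 2) *: f,
  bandlimited ip T K f' & ip f' f' <= L ^+ 2 * ip f f].
have step u : bandlimited ip T K u -> exists u', Q u u'.
  move=> Wu; have [||//|g [Tg Wg ng]] :=
    @bandlimited_shift_norm _ _ _ hip _ symT K (s * B * 2) L u K0 L0.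
  - lra.
  - move=> v w Wv Tv; apply: le_trans (landau_lower Tv).
    by rewrite ler_wpM2r ?(ip_ge0 hip) //; lra.
  - by exists (g - (s * B * 2) *: u), g.
(* [choice] needs a total relation; for vectors that are not band-limited the value u is a dummy. *)
have stepw u : exists u', bandlimited ip T K u -> Q u u'.
  have [Wu|nWu] := pselect (bandlimited ip T K u); last by exists u.
  by have [u' qu] := step u Wu; exists u'.
have [F hF] := choice stepw.
(* [h n] is (T - 2 s B)^n f. The ladder operator applied to it, [d n] below, runs through an orbit
   of T by [ladder_intertwine]. *)
pose h n := iter n F f.
have Wh n : bandlimited ip T K (h n).
  elim: n => // n IH; have [g [_ _ W _]] := hF _ IH; exact: W.
have Qh n : Q (h n) (h n.+1) by exact: hF (Wh n).
have nh n : ip (h n) (h n) <= (L ^+ 2) ^+ n * ip f f.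
  elim: n => [|n IH]; first by rewrite expr0 mul1r.
  have [g [_ _ _ hn]] := Qh n; apply: (le_trans hn).
  by rewrite [_ ^+ n.+1]exprS -[X in _ <= X]mulrA; apply: ler_wpM2l => //; exact: sqr_ge0.
have exd n : exists d, weak_ladder s (h n) d /\ ip d d <= (K - s * B) * ip (h n) (h n).
  have [g [Tg _ _ _]] := Qh n.
  have [d wd dd] := weak_ladder_exists cpl s1 Tg.
  exists d; split => //; rewrite dd mulrBl lerD2r.
  exact: (bandlimited_form hip symT K0 (Wh n) Tg).
have [d hd] := choice exd.
exists (d 0%N); split; [exact: (hd 0%N).1| |exact: (hd 0%N).2].
exists d; split => // [n|].
  have [g [Tg hg _ _]] := Qh n.
  apply: (ladder_intertwine sa s1 Tg (hd n).1).
  by rewrite -hg; exact: (hd n.+1).1.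
exists (`|K - s * B| * ip f f) => n; apply: (le_trans (hd n).2).
apply: (@le_trans _ _ (`|K - s * B| * ip (h n) (h n))).
  by rewrite ler_wpM2r ?(ip_ge0 hip) // ler_norm.
by have := ler_wpM2l (normr_ge0 (K - s * B)) (nh n); rewrite mulrA mulrAC.
Qed.

(* Weighted AM-GM for the factors M - m B and M + B (m times). *)
Lemma mul_expr_le_expr (M c : R) m : 0 <= c -> m%:R * c <= M ->
  (M - m%:R * c) * (M + c) ^+ m <= M ^+ m.+1.
Proof.
move=> c0; elim: m => [|m IH] mM; first by rewrite mul0r subr0 expr0 mulr1.
have M0 : 0 <= M by apply: le_trans mM; rewrite mulr_ge0.
have mM' : m%:R * c <= M.
  by apply: le_trans mM; rewrite ler_wpM2r // ler_nat.
have P0 : 0 <= (M + c) ^+ m by rewrite exprn_ge0 // addr_ge0.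
have m0 : 0 <= m%:R :> R by exact: ler0n.
(* The inductive step is (M - (m + 1) c) (M + c) <= M (M - m c); the two sides differ by (m + 1)
   c^2. *)
apply: le_trans (_ : M * ((M - m%:R * c) * (M + c) ^+ m) <= _); last first.
  by rewrite [X in _ <= X]exprS ler_wpM2l // IH.
rewrite exprS !mulrA ler_wpM2r // -natr1.
have : 0 <= (m%:R + 1) * (c * c) by rewrite mulr_ge0 // ?addr_ge0 // mulr_ge0.
lra.
Qed.

Definition word_op (s : seq 'I_2) (u : V) : V :=
  foldr (fun j : 'I_2 => if j == 0 then D0 else D1) u s.

Lemma tst_word s u : tst u -> tst (word_op s u).
Proof. by move=> hu; elim: s => //= j s IH; case: ifP => _; [exact: t0|exact: t1]. Qed.

Lemma word_opJ s u : tst u -> word_op s (J u) = J (word_op s u).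
Proof.
move=> hu; elim: s => //= j s ->; have := tst_word s hu => tw.
by case: ifP => _; [rewrite (opJ hD0 tw)|rewrite (opJ hD1 tw)].
Qed.

(** The induction peels off the last letter, the derivative that acts on f first, and applies the
    hypothesis to a f and a* f with their own energy bounds. K is therefore quantified inside the
    induction. *)
Theorem bandlimited_bernstein m : forall (K : R) f, 0 <= K -> bandlimited ip T K f ->
  exists g : m.-tuple 'I_2 -> V,
    (forall a psi, tst psi -> ip (g a) psi = ip f (word_op (rev a) psi)) /\
    \sum_a ip (g a) (g a) <= (K + B * m%:R) ^+ m * ip f f.
Proof.
elim: m => [|m IH] K f K0 Wf.
  exists (fun=> f); split => [a psi tpsi|].
    by rewrite /word_op tuple0.
  rewrite expr0 mul1r (eq_bigr (fun=> ip f f)) // sumr_const card_tuple expn0 mulr1n //.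
have [d [wd Wd nd]] : exists d, [/\ weak_ladder 1 f d, bandlimited ip T (K + B) d &
    ip d d <= (K - 1 * B) * ip f f].
  by apply: (bandlimited_ladder K0) Wf; [by move: B0; lra|by move: B0; lra|rewrite expr1n].
have [e [we We ne]] : exists d, [/\ weak_ladder (- 1) f d,
    bandlimited ip T (K + B * 2) d & ip d d <= (K - (- 1) * B) * ip f f].
  by apply: (bandlimited_ladder K0) Wf; [by move: B0; lra|by move: B0; lra|rewrite sqrrN expr1n].
have [G [hG nG]] := IH _ _ (addr_ge0 K0 B0) Wd.
have [|G' [hG' nG']] := IH _ _ _ We; first by move: B0; lra.
pose init (a : m.+1.-tuple 'I_2) : m.-tuple 'I_2 := [tuple of belast (thead a) (behead a)].
pose lst (a : m.+1.-tuple 'I_2) := last (thead a) (behead a).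
have initE (a : m.+1.-tuple 'I_2) : (a : seq _) = rcons (init a) (lst a).
  by rewrite -lastI [in LHS](tuple_eta a).
pose snoc (b : m.-tuple 'I_2) j : m.+1.-tuple 'I_2 := [tuple of rcons b j].
have snocK b j : init (snoc b j) = b /\ lst (snoc b j) = j.
  have /rcons_inj[e1 e2] : rcons b j = rcons (init (snoc b j)) (lst (snoc b j)).
    by rewrite -initE.
  by split=> //; apply: val_inj.
(* D0 = (a* + a) / 2 and D1 = J (a* - a) / 2, where [G] and [G'] hold the remaining m derivatives of
   a f and of a* f. *)
pose g (a : m.+1.-tuple 'I_2) : V := if lst a == 0
  then 2^-1 *: (G (init a) + G' (init a)) else 2^-1 *: J (G' (init a) - G (init a)).
exists g; split.
  move=> a psi tpsi.
  have -> : word_op (rev a) psi = (if lst a == 0 then D0 else D1) (word_op (rev (init a)) psi).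
    by rewrite initE rev_rcons.
  have := tst_word (rev (init a)) tpsi; set chi := word_op _ _ => tchi.
  have hGJ phi : tst phi -> ip (G (init a)) phi = ip f (ladder (- 1) (word_op (rev (init a)) phi)).
    by move=> tphi; rewrite hG // wd //; exact: tst_word.
  have hGJ' phi : tst phi -> ip (G' (init a)) phi = ip f (ladder 1 (word_op (rev (init a)) phi)).
    by move=> tphi; rewrite hG' // we ?opprK //; exact: tst_word.
  have wJ := word_opJ (rev (init a)) tpsi.
  rewrite /g; case: ifP => _.
    rewrite (ipZl hip) (ipDl hip) hGJ // hGJ' // -(ipDr hip) -/chi /ladder_op.
    rewrite scale1r scaleN1r addrACA addNr addr0 (ipDr hip).
    by field.
  rewrite (ipZl hip) ipJl (ipDl hip) (ipNl hip) hGJ ?hGJ' //; try exact: (tstJ hm).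
  rewrite wJ /ladder_op !(opJ hD0 tchi, opJ hD1 tchi) (JJ hm).
  rewrite !(ipDr hip, ipNr hip, ipZr hip). by field.
(* Parallelogram law over the two values of the last letter; [J] preserves the norm. *)
have -> : \sum_a ip (g a) (g a) =
    2^-1 * (\sum_b ip (G b) (G b) + \sum_b ip (G' b) (G' b)).
  rewrite -big_split mulr_sumr /=.
  rewrite (reindex (fun p : m.-tuple 'I_2 * 'I_2 => snoc p.1 p.2)) /=; last first.
    exists (fun a => (init a, lst a)) => [[b j] _|a _].
      by have [-> ->] := snocK b j.
    by apply: val_inj; rewrite /= -initE.
  rewrite -(pair_bigA _ (fun b j => ip (g (snoc b j)) (g (snoc b j)))) /=.
  apply: eq_bigr => b _; rewrite big_ord_recl big_ord1.
  rewrite /g !(snocK _ _).1 !(snocK _ _).2 /=.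
  move: (G b) (G' b) => x y.
  rewrite !(ipZl hip, ipZr hip) (ipJ hm) !(ipE hip) (ipC hip y x). by field.
pose M := K + B * m.+1%:R.
have M0 : 0 <= M by rewrite addr_ge0 // mulr_ge0 // ler0n.
have nf := ip_ge0 hip f.
have b1 : \sum_b ip (G b) (G b) <= M ^+ m.+1 * ip f f.
  apply: (le_trans nG).
  rewrite (_ : K + B + B * m%:R = M); last by rewrite /M -natr1; ring.
  rewrite exprSr -mulrA ler_wpM2l ?exprn_ge0 //; apply: (le_trans nd).
  rewrite ler_wpM2r // /M -natr1.
  have : 0 <= B * m%:R by rewrite mulr_ge0 // ler0n.
  by move: B0; lra.
have b2 : \sum_b ip (G' b) (G' b) <= M ^+ m.+1 * ip f f.
  apply: (le_trans nG').
  rewrite (_ : K + B * 2 + B * m%:R = M + B); last by rewrite /M -natr1; ring.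
  (* Here K + B = M - m B, the shape that [mul_expr_le_expr] expects. *)
  apply: le_trans (_ : (M - m%:R * B) * (M + B) ^+ m * ip f f <= _); last first.
    rewrite ler_wpM2r // mul_expr_le_expr // /M -natr1.
    by move: B0 K0; lra.
  have P0 : 0 <= (M + B) ^+ m by rewrite exprn_ge0 // addr_ge0.
  apply: (le_trans (ler_wpM2l P0 ne)).
  rewrite (_ : M - m%:R * B = K - -1 * B); last by rewrite /M -natr1; ring.
  by rewrite le_eqVlt; apply/orP; left; apply/eqP; ring.
rewrite -/M; lra.
Qed.
End MagneticAlgebra.
Arguments word_op {R V} D0 D1 s u.
Arguments selfadjoint_graph {R V} ip tst D0 D1.

(** * Spectral measures *)

Section MeasureBounds.
Context {R : realType} (nu : {measure set (measurableTypeR R) -> \bar R}).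

(** The complement of S is null, so all integrals may be taken over S, where the identity stays
    between a and b. *)
Lemma bounded_support_integrals (S : set (measurableTypeR R)) (a b : R) :
  measurable S -> S `<=` `[a, b] -> (nu setT < +oo)%E -> nu (~` S) = 0%E ->
  [/\ (\int[nu]_x (x ^+ 2)%:E < +oo)%E,
      nu.-integrable setT (EFin \o (id : R -> R)) &
      a * fine (nu setT) <= Rintegral nu setT id <= b * fine (nu setT)].
Proof.
move=> mS Sab fin nS0.
have mid : measurable_fun (setT : set (measurableTypeR R)) (id : measurableTypeR R -> R).
  exact: measurable_id.
have nST : nu S = nu setT.
  by rewrite -(setvU S) measureU //= ?nS0 ?add0e //; [exact: measurableC|rewrite setICl].
have SC : setT `\` ~` S = S by rewrite setTD setCK.
have finS : (nu S < +oo)%E by rewrite nST.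
have bint (h : measurableTypeR R -> R) (c : R) : measurable_fun setT h ->
    (forall x, S x -> `|h x| <= c) -> nu.-integrable S (EFin \o h).
  move=> mh hc; apply: (@measurable_bounded_integrable _ _ _ nu h S) => //.
    exact: measurable_funTS.
  exists `|c|; split; first exact: num_real.
  by move=> x cx y /hc /le_trans; apply; rewrite (le_trans (ler_norm c)) // ltW.
have Sb x : S x -> a <= x <= b by move=> /Sab /=; rewrite in_itv.
pose c := `|a| + `|b|.
have xc x : S x -> `|x| <= c.
  move=> /Sb /andP[ax xb]; rewrite ler_norml /c.
  have := ler_norm b; have := ler_norm (- a); rewrite normrN.
  by have := normr_ge0 a; have := normr_ge0 b; lra.
have idS : nu.-integrable S (EFin \o (id : R -> R)) by exact: (bint id c).
have idT : nu.-integrable setT (EFin \o (id : R -> R)).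
  rewrite (@negligible_integrable _ _ _ nu setT (~` S)) ?SC //.
  - exact: measurableC.
  - exact/measurable_EFinP.
split => //.
  rewrite (@ge0_negligible_integral _ _ _ nu setT (~` S)) ?SC //; last 3 first.
  - exact: measurableC.
  - by apply/measurable_EFinP; exact: measurable_funX.
  - by move=> x _; rewrite lee_fin sqr_ge0.
  have /integrableP[_] : nu.-integrable S (EFin \o (fun x => x ^+ 2 : R)).
    apply: (bint _ (c ^+ 2)); first exact: measurable_funX.
    by move=> x /xc xcx; rewrite normrX lerXn2r // nnegrE // (le_trans _ xcx).
  apply: le_lt_trans; apply: ge0_le_integral => //.
  - by move=> x _; rewrite lee_fin sqr_ge0.
  - by apply/measurable_EFinP; apply: measurable_funTS; exact: measurable_funX.
  - apply: measurableT_comp => //.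
    by apply/measurable_EFinP; apply: measurable_funTS; exact: measurable_funX.
  - by move=> x _; rewrite lee_fin ler_norm.
rewrite /Rintegral (@negligible_integral _ _ _ nu setT (~` S)) ?SC //; last exact: measurableC.
rewrite -nST -!(@Rintegral_cst _ _ _ nu S mS) -/(Rintegral nu S id).
by apply/andP; split; apply: le_Rintegral => //;
  do ?[by apply: (bint _ `|a|) | by apply: (bint _ `|b|)]; move=> x /Sb /andP[].
Qed.

End MeasureBounds.

Section SpectralMeasure.
Context {R : realType} {V : lmodType R}.
Local Notation line := (measurableTypeR R).

(** The given spectral measure respects its identities almost everywhere, so they are restated after
    pairing with a vector. Linearity of [P S] needs no field: paired with v, [P S u] is <u, P S v>,
    which is linear in u. *)
Record weak_spectral_measure (ip : V -> V -> R) (T : V -> V -> Prop)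
    (P : set line -> V -> V) : Prop := WeakSpectralMeasure {
  wsm_sym : forall S u v, measurable S -> ip (P S u) v = ip u (P S v) ;
  wsm_setI : forall S1 S2 u v, measurable S1 -> measurable S2 ->
    ip (P (S1 `&` S2) u) v = ip (P S1 (P S2 u)) v ;
  wsm_setT : forall u v, ip (P setT u) v = ip u v ;
  wsm_measure : forall u, exists nu : {measure set line -> \bar R},
    forall S, measurable S -> nu S = (ip (P S u) u)%:E ;
  wsm_spectral : forall u (nu : {measure set line -> \bar R}),
    (forall S, measurable S -> nu S = (ip (P S u) u)%:E) ->
    ((exists g, T u g) <-> (\int[nu]_x (x ^+ 2)%:E < +oo)%E) /\
    (forall g, T u g -> ip g u = Rintegral nu setT id) }.

Context {ip : V -> V -> R} (hip : semi_inner ip).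
Context {T : V -> V -> Prop} (hT : symmetric_graph ip T) (cT : closed_graph ip T).
Local Notation seg a b := (`[a, b]%classic : set line).
Local Notation ray a := (`]-oo, a]%classic : set line).
Local Notation neg := (`]-oo, 0[%classic : set line).
Context {P : set line -> V -> V} (hP : weak_spectral_measure ip T P).

Definition spectral_range (S : set line) (u : V) : Prop := forall v, ip (P S u) v = ip u v.

Lemma wsm_set0 u v : ip (P set0 u) v = 0.
Proof.
have [nu hnu] := wsm_measure hP u.
have := hnu set0 measurable0; rewrite measure0 => -[e].
have z : ip (P set0 u) (P set0 u) = 0.
  rewrite (wsm_sym hP) // (ipC hip) -(wsm_setI hP) //.
  by rewrite setI0 -e.
exact: (ip_null hip).
Qed.

Lemma spectral_range_proj S u : measurable S -> spectral_range S (P S u).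
Proof. by move=> mS v; rewrite -(wsm_setI hP) // setIid. Qed.

(** Allows a change of representative: membership in the range of a projection is only known almost
    everywhere. *)
Lemma spectral_range_eq S u u' : measurable S -> (forall v, ip u v = ip u' v) ->
  spectral_range S u' -> spectral_range S u.
Proof. by move=> mS uu hu v; rewrite (wsm_sym hP) // !uu -(wsm_sym hP). Qed.

Lemma spectral_range_projS S S' u : measurable S -> measurable S' ->
  spectral_range S u -> spectral_range S (P S' u).
Proof.
move=> mS mS' hu v.
rewrite -(wsm_setI hP) // setIC (wsm_setI hP) // (wsm_sym hP) // hu.
by rewrite (wsm_sym hP).
Qed.

Lemma spectral_rangeD S t u v : measurable S ->
  spectral_range S u -> spectral_range S v -> spectral_range S (u + t *: v).
Proof.
move=> mS hu hv w; rewrite (wsm_sym hP) // !(ipDl hip, ipZl hip).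
by rewrite -!(wsm_sym hP) // hu hv.
Qed.

Lemma spectral_range_disjoint S S' u w : measurable S -> measurable S' ->
  S `&` S' = set0 -> spectral_range S u -> spectral_range S' w -> ip u w = 0.
Proof.
move=> mS mS' SS' hu hw; rewrite -hu (ipC hip) -hw (wsm_sym hP) // (ipC hip).
by rewrite -(wsm_setI hP) // setIC SS' wsm_set0.
Qed.

(** Additivity is available on the diagonal only. Together with orthogonality of the two ranges it
    shows that the defect [y] has norm zero, which gives the identity against every v. *)
Lemma wsm_setC S u v : measurable S -> ip (P (~` S) u) v = ip u v - ip (P S u) v.
Proof.
move=> mS; have mSC : measurable (~` S) by exact: measurableC.
pose y := u - P S u - P (~` S) u.
suff y0 : ip y y = 0.
  by have := ip_null hip v y0; rewrite /y !(ipE hip); lra.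
have [nu hnu] := wsm_measure hP u.
have e : ip u u = ip (P S u) u + ip (P (~` S) u) u.
  have : nu (S `|` ~` S) = (nu S + nu (~` S))%E by rewrite measureU //; exact: setICr.
  by rewrite setUC setvU !hnu // -EFinD (wsm_setT hP) => -[].
have n S' : measurable S' -> ip (P S' u) (P S' u) = ip (P S' u) u.
  by move=> mS'; rewrite [in LHS](wsm_sym hP) // (ipC hip) spectral_range_proj.
have d : ip (P S u) (P (~` S) u) = 0.
  apply: (@spectral_range_disjoint S (~` S)) => //; first exact: setICr.
  - exact: spectral_range_proj.
  - exact: spectral_range_proj.
rewrite /y !(ipE hip) !n // d (ipC hip (P (~` S) u) (P S u)) d.
by rewrite (ipC hip u (P S u)) (ipC hip u (P (~` S) u)); lra.
Qed.

Lemma spectral_range_bounded S (a b : R) u : measurable S -> S `<=` `[a, b] ->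
  spectral_range S u -> exists nu : {measure set line -> \bar R},
  [/\ forall A, measurable A -> nu A = (ip (P A u) u)%:E,
      (\int[nu]_x (x ^+ 2)%:E < +oo)%E,
      nu.-integrable setT (EFin \o (id : R -> R)) &
      a * ip u u <= Rintegral nu setT id <= b * ip u u].
Proof.
move=> mS Sab hu; have [nu hnu] := wsm_measure hP u; exists nu.
have nT : nu setT = (ip u u)%:E by rewrite hnu // (wsm_setT hP).
have [||h1 h2 h3] := bounded_support_integrals mS Sab (nu := nu).
- by rewrite nT ltry.
- by rewrite hnu ?wsm_setC ?hu ?subrr //; exact: measurableC.
by split => //; move: h3; rewrite nT.
Qed.

Lemma spectral_range_dom S (a b : R) u : measurable S -> S `<=` `[a, b] ->
  spectral_range S u -> exists g, T u g.
Proof.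
move=> mS Sab hu; have [nu [hnu fin _ _]] := spectral_range_bounded mS Sab hu.
exact/(wsm_spectral hP hnu).1.
Qed.

Lemma spectral_range_form S (a b : R) u g : measurable S -> S `<=` `[a, b] ->
  spectral_range S u -> T u g -> a * ip u u <= ip g u <= b * ip u u.
Proof.
move=> mS Sab hu Tug; have [nu [hnu _ _]] := spectral_range_bounded mS Sab hu.
by rewrite ((wsm_spectral hP hnu).2 _ Tug).
Qed.

(* The quadratic form of T is additive on orthogonal spectral subspaces, hence
   T preserves them. *)
Lemma spectral_range_ortho S S' (a b a' b' : R) u w v :
  measurable S -> measurable S' -> S `<=` `[a, b] -> S' `<=` `[a', b'] ->
  S `&` S' = set0 -> spectral_range S u -> spectral_range S' w -> T u v ->
  ip v w = 0.
Proof.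
move=> mS mS' Sab Sab' SS' hu hw Tuv.
have [nu1 [h1 _ i1 _]] := spectral_range_bounded mS Sab hu.
have [nu2 [h2 _ i2 _]] := spectral_range_bounded mS' Sab' hw.
have [z Twz] := spectral_range_dom mS' Sab' hw.
(* Cross terms vanish for every A, so the scalar spectral measure of u + w is the sum of those of u
   and w. *)
have hnu A : measurable A -> measure_add nu1 nu2 A = (ip (P A (u + w)) (u + w))%:E.
  move=> mA; rewrite measure_addE h1 // h2 // -EFinD; congr (_%:E).
  rewrite [RHS](wsm_sym hP) // !(ipDl hip) -!(wsm_sym hP) // !(ipDr hip).
  have d1 : ip (P A u) w = 0.
    by apply: (@spectral_range_disjoint S S') => //; exact: spectral_range_projS.
  have d2 : ip (P A w) u = 0.
    rewrite (ipC hip); apply: (@spectral_range_disjoint S S') => //.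
    exact: spectral_range_projS.
  by rewrite d1 d2 addr0 add0r.
(* The form at u + w thus equals the sum of the forms at u and w. The mixed terms <v, w> and <z, u>
   agree by symmetry, hence both are zero. *)
have := (wsm_spectral hP hnu).2 _ (graphD hT Tuv Twz).
rewrite /Rintegral integral_measure_add // fineD; first last.
- exact: integrable_fin_num i2.
- exact: integrable_fin_num i1.
rewrite -/(Rintegral nu1 setT id) -/(Rintegral nu2 setT id).
rewrite -((wsm_spectral hP h1).2 _ Tuv) -((wsm_spectral hP h2).2 _ Twz).
have := graph_sym hT Tuv Twz; rewrite !(ipE hip) (ipC hip u z); lra.
Qed.

(** Continuity from below of the scalar spectral measure, since |P u - u|^2 = |u|^2 - <P u, u> for a
    projection. *)
Lemma itv_centered_lim u : vlim ip (fun n => P (seg (- n%:R) n%:R) u) u.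
Proof.
have [nu hnu] := wsm_measure hP u.
pose F n : set line := (seg (- n%:R) n%:R).
have mF n : measurable (F n) by exact: measurable_itv.
have FT : \bigcup_n F n = setT.
  apply/seteqP; split => // x _; exists (Num.bound `|x|) => //=.
  rewrite /F /= in_itv /= -ler_norml; apply: le_trans (ltW (archi_boundP (normr_ge0 x))) _.
  by rewrite ler_nat; exact: leqnn.
have := @nondecreasing_cvg_mu _ _ _ nu F mF; rewrite FT => /(_ measurableT).
have ndF : nondecreasing_seq F.
  move=> n m nm; apply/subsetPset => x; rewrite /F /= !in_itv /= => /andP[h1 h2].
  have nm' : n%:R <= m%:R :> R by rewrite ler_nat.
  by apply/andP; split; lra.
move=> /(_ ndF); rewrite hnu // (wsm_setT hP).
have -> : nu \o F = EFin \o (fun n => ip (P (F n) u) u).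
  by apply/funext => n /=; rewrite hnu.
move=> /fine_cvgP[_]; rewrite (_ : fine \o _ = (fun n => ip (P (F n) u) u)) // => h.
rewrite /vlim (_ : (fun _ => _) = (fun n => ip u u - ip (P (F n) u) u)).
  by rewrite -(subrr (ip u u)); apply: cvgB => //; exact: cvg_cst.
apply/funext => n; rewrite -/(F n) !(ipE hip) [ip (P _ u) (P _ u)](wsm_sym hP) //.
by rewrite (ipC hip u (P _ (P _ u))) (spectral_range_proj _ (mF n)) (ipC hip u); lra.
Qed.

(** v has to be orthogonal to the range of the complement. That set is unbounded, so
    [spectral_range_ortho] is applied to its intersections with [-n, n] and n tends to infinity. *)
Lemma spectral_range_graph (a b : R) u v :
  spectral_range (seg a b) u -> T u v -> spectral_range (seg a b) v.
Proof.
move=> hu Tuv h; have mS : measurable (seg a b) by exact: measurable_itv.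
have mF n : measurable ((seg (- n%:R) n%:R) : set line) by exact: measurable_itv.
suff : ip v (P (~` (seg a b)) h) = 0.
  rewrite -(wsm_sym hP); last exact: measurableC.
  by rewrite wsm_setC // => /eqP; rewrite subr_eq0 => /eqP.
have lim := ip_vlim hip (w := v) (itv_centered_lim (P (~` (seg a b)) h)).
rewrite (ipC hip); apply: (cvg_unique _ lim) => //.
rewrite (_ : (fun n => _) = cst 0); first exact: cvg_cst.
apply/funext => n /=.
have mC : measurable (~` seg a b) by exact: measurableC.
have mI : measurable ((seg (- n%:R) n%:R) `&` ~` (seg a b) : set line) by exact: measurableI.
rewrite -(wsm_setI hP) // (ipC hip).
apply: (@spectral_range_ortho (seg a b) ((seg (- n%:R) n%:R) `&` ~` (seg a b))
  a b (- n%:R) n%:R u) => //.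
  by rewrite setIA [X in X `&` _]setIC -setIA setICr setI0.
exact: spectral_range_proj.
Qed.

Lemma graph_null u v u' v' : T u v -> ip (u - u') (u - u') = 0 ->
  ip (v - v') (v - v') = 0 -> T u' v'.
Proof.
move=> Tuv uu vv; apply: (cT (u := fun=> u) (v := fun=> v)) => //.
  exact: (vlim_shift hip (vlim_cst hip u)).
exact: (vlim_shift hip (vlim_cst hip v)).
Qed.

(** The truncation of f to [-n, n] is in the domain, and testing against truncated vectors shows
    that its image is the truncation of g. Closedness gives the limit. *)
Lemma weak_spectral_selfadjoint f g : (forall u v, T u v -> ip f v = ip g u) -> T f g.
Proof.
move=> fg.
pose F n : set line := (seg (- n%:R) n%:R).
have mF n : measurable (F n) by exact: measurable_itv.
apply: (cT (u := fun n => P (F n) f) (v := fun n => P (F n) g)); first last.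
- exact: itv_centered_lim.
- exact: itv_centered_lim.
move=> n; have [w Tw] := spectral_range_dom (mF n) (@subset_refl _ _) (spectral_range_proj f (mF n)).
have rw := spectral_range_graph (spectral_range_proj f (mF n)) Tw.
apply: (graph_null Tw); first by rewrite subrr (ip0l hip).
apply: (ip_eq0 (ip := ip)) => h; rewrite !(ipE hip) -rw (wsm_sym hP) // [X in _ - X](wsm_sym hP) //.
have [k Tk] := spectral_range_dom (mF n) (@subset_refl _ _) (spectral_range_proj h (mF n)).
have rk := spectral_range_graph (spectral_range_proj h (mF n)) Tk.
rewrite (graph_sym hT Tw Tk) (wsm_sym hP) // (ipC hip) rk (ipC hip) (fg _ _ Tk).
by rewrite subrr.
Qed.

Context (posT : forall u g, T u g -> 0 <= ip g u).

(** On the range of [-n, -1 / (n + 1)] the form of T is at most -|u|^2 / (n + 1), so positivity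
    makes this range null. These intervals cover the negative half-line. *)
Lemma spectral_range_nonneg (E : R) f :
  spectral_range (ray E) f -> spectral_range (seg 0 E) f.
Proof.
move=> hf.
have [nu hnu] := wsm_measure hP f.
pose G n : set line := (seg (- n%:R) (- n.+1%:R^-1)).
have mG n : measurable (G n) by exact: measurable_itv.
have nG n : nu (G n) = 0%E.
  have rG := spectral_range_proj f (mG n).
  have [g Tg] := spectral_range_dom (mG n) (@subset_refl _ _) rG.
  have /andP[_ h] := spectral_range_form (mG n) (@subset_refl _ _) rG Tg.
  have := posT Tg => h0.
  have n0 : 0 < n.+1%:R^-1 :> R by rewrite invr_gt0 ltr0n.
  have z : ip (P (G n) f) (P (G n) f) = 0.
    apply/eqP; rewrite eq_le (ip_ge0 hip) andbT.
    by have := le_trans h0 h; rewrite mulNr oppr_ge0 pmulr_rle0.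
  by rewrite hnu // (ip_null hip _ z).
have mN : measurable (neg : set line) by exact: measurable_itv.
have NG : neg `<=` \bigcup_n G n.
  move=> x /=; rewrite in_itv /= => x0.
  have nx0 : 0 < - x by rewrite oppr_gt0.
  have ix0 : 0 < (- x)^-1 by rewrite invr_gt0.
  pose n := maxn (Num.bound (- x)) (Num.bound (- x)^-1).
  exists n => //=; rewrite /G /= in_itv /=; apply/andP; split.
    rewrite lerNl; apply: le_trans (ltW (archi_boundP (ltW nx0))) _.
    by rewrite ler_nat leq_maxl.
  rewrite lerNr -[leRHS]invrK lef_pV2 ?posrE ?ltr0n //.
  apply: le_trans (ltW (archi_boundP (ltW ix0))) _.
  by rewrite ler_nat leqW // leq_maxr.
have nN : nu neg = 0%E.
  have ng : nu.-negligible (\bigcup_n G n).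
    by apply: negligible_bigcup => k; exists (G k); split.
  by apply: measure_negligible => //; exact: negligibleS ng.
have pN v : ip (P neg f) v = 0.
  apply: (ip_null hip); rewrite (wsm_sym hP) // (ipC hip) spectral_range_proj //.
  by have := hnu _ mN; rewrite nN => -[].
have mC : measurable (~` neg : set line) by exact: measurableC.
have mE : measurable ((ray E) : set line) by exact: measurable_itv.
have -> : (seg 0 E) = (ray E) `&` ~` neg :> set line.
  apply/seteqP; split => x; rewrite /= !in_itv /=.
    by move=> /andP[x0 xE]; split => //; apply/negP; rewrite -leNgt.
  by move=> [xE /negP]; rewrite -leNgt => ->.
move=> v; rewrite (wsm_setI hP) // (wsm_sym hP) // wsm_setC // pN subr0.
by rewrite -(wsm_sym hP) // hf.
Qed.

(** [invariant_shift_norm] with c = 0 and L = E turns the form bounds on the spectral subspace of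
    [0, E] into |T u| <= E |u|, which is then iterated. *)
Lemma spectral_range_bandlimited (E : R) f : 0 <= E ->
  spectral_range (ray E) f -> bandlimited ip T E f.
Proof.
move=> E0 /spectral_range_nonneg rf.
have mS : measurable (seg 0 E) by exact: measurable_itv.
pose Q u u' := [/\ T u u', spectral_range (seg 0 E) u' & ip u' u' <= E ^+ 2 * ip u u].
have step u : spectral_range (seg 0 E) u -> exists u', Q u u'.
  move=> ru.
  have WD t x y : spectral_range (seg 0 E) x -> spectral_range (seg 0 E) y ->
    spectral_range (seg 0 E) (x + t *: y) by exact: spectral_rangeD.
  have Wstep x : spectral_range (seg 0 E) x -> exists2 y, T x y & spectral_range (seg 0 E) y.
    move=> rx; have [y Txy] := spectral_range_dom mS (@subset_refl _ _) rx.
    by exists y => //; exact: spectral_range_graph Txy.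
  have Wform x y : spectral_range (seg 0 E) x -> T x y ->
      (0 - E) * ip x x <= ip y x <= (0 + E) * ip x x.
    move=> rx Txy; have := spectral_range_form mS (@subset_refl _ _) rx Txy.
    rewrite mul0r !add0r => /andP[h1 ->]; rewrite andbT.
    by apply: le_trans h1; rewrite mulNr oppr_le0 mulr_ge0 // (ip_ge0 hip).
  have [g []] := invariant_shift_norm hip hT E0 WD Wstep Wform ru.
  by rewrite scale0r subr0 => Tg Wg ng; exists g.
have stepw u : exists u', spectral_range (seg 0 E) u -> Q u u'.
  have [ru|nru] := pselect (spectral_range (seg 0 E) u); last by exists u.
  by have [u' qu] := step u ru; exists u'.
have [F hF] := choice stepw.
have rF n : spectral_range (seg 0 E) (iter n F f).
  by elim: n => // n IH; have [_ + _] := hF _ IH.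
exists (fun n => iter n F f); split => // [n|].
  by have [+ _ _] := hF _ (rF n).
exists (ip f f) => n; elim: n => [|n IH]; first by rewrite expr0 mulr1.
have [_ _ h] := hF _ (rF n); apply: (le_trans h).
by rewrite [_ ^+ n.+1]exprS mulrCA; apply: ler_wpM2l => //; exact: sqr_ge0.
Qed.

End SpectralMeasure.
Arguments spectral_range {R V} ip P S u.

(** * The space of square integrable functions *)

Section L2space.
Context {R : realType}.
Local Notation plane := (measurableTypeR R * measurableTypeR R)%type.
Local Notation Re := (@complex.Re R).
Local Notation Im := (@complex.Im R).
Implicit Types f g : R * R -> R[i].

Definition rdot f g (x : plane) : R := Re (f x) * Re (g x) + Im (f x) * Im (g x).

Definition L2ip f g : R := Rintegral leb2 setT (rdot f g).

Lemma inner_Re f g : Re (inner f g) = L2ip f g.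
Proof.
apply: eq_Rintegral => x _; rewrite /rdot.
by case: (f x) (g x) => [a b] [c d] /=; rewrite mulrN opprK.
Qed.

Lemma normc_sqr (z : R[i]) : ComplexField.Normc.normc z ^+ 2 = Re z * Re z + Im z * Im z.
Proof. by case: z => a b /=; rewrite sqr_sqrtr ?addr_ge0 ?sqr_ge0 // !expr2. Qed.

Lemma poweR2 (x : \bar R) : (0 <= x -> x `^ 2 = x ^+ 2)%E.
Proof.
case: x => [r|_|//].
  by rewrite lee_fin => r0; rewrite poweR_EFin powR_mulrn // EFin_expe.
by rewrite poweRyr ?pnatr_eq0 // expe2 mulyy.
Qed.

Lemma rdot_ge0 f x : 0 <= rdot f f x.
Proof. by rewrite /rdot -!expr2 addr_ge0 ?sqr_ge0. Qed.

Lemma L2norm_sqr f : (L2norm f ^+ 2 = \int[leb2]_x (rdot f f x)%:E)%E.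
Proof.
rewrite -poweR2 ?Lnorm_ge0 // /L2norm poweR_Lnorm ?pnatr_eq0 //.
apply: eq_integral => x _ /=.
by rewrite ger0_norm ?sqrtr_ge0 // ?poweR_EFin ?powR_mulrn ?normc_sqr //; case: (f x) => a b; exact: sqrtr_ge0.
Qed.

Lemma L2norm_lty f : (L2norm f < +oo)%E <-> (\int[leb2]_x (rdot f f x)%:E < +oo)%E.
Proof.
rewrite -L2norm_sqr; have := Lnorm_ge0 leb2 2%:E (fun x => (ComplexField.Normc.normc (f x))%:E).
rewrite -/(L2norm f); case: (L2norm f) => [r| |] // r0; first by rewrite -EFin_expe !ltry.
Qed.

Lemma L2P f : L2 f <-> [/\ measurable_fun setT ((fun x => Re (f x)) : plane -> R),
   measurable_fun setT ((fun x => Im (f x)) : plane -> R) &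
   leb2.-integrable setT (EFin \o rdot f f)].
Proof.
split=> -[mr mi].
  move=> /L2norm_lty h; split => //; apply/integrableP; split.
    apply/measurable_EFinP; apply: measurable_funD; exact: measurable_funM.
  rewrite (eq_integral (fun x => (rdot f f x)%:E)) // => x _ /=.
  by rewrite ger0_norm // rdot_ge0.
move=> /integrableP[_ h]; split => //; apply/L2norm_lty.
rewrite (eq_integral (fun x => `|(EFin \o rdot f f) x|%E)) // => x _ /=.
by rewrite ger0_norm // rdot_ge0.
Qed.

Lemma measurable_rdot f g : L2 f -> L2 g -> measurable_fun setT (rdot f g).
Proof. by move=> [? ? _] [? ? _]; apply: measurable_funD; exact: measurable_funM. Qed.

Lemma integrable_rdot f g : L2 f -> L2 g -> leb2.-integrable setT (EFin \o rdot f g).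
Proof.
move=> Lf Lg; have [_ _ If] := (L2P f).1 Lf; have [_ _ Ig] := (L2P g).1 Lg.
apply: (le_integrable _ _ _ (integrableD measurableT If Ig)) => //.
  by apply/measurable_EFinP; exact: measurable_rdot.
move=> x _ /=; rewrite lee_fin [leRHS]ger0_norm; last by apply: addr_ge0; exact: rdot_ge0.
rewrite /rdot.
move: (Re _) (Im _) (Re _) (Im _) => a b c d.
rewrite ler_norml.
have := sqr_ge0 (a + c); have := sqr_ge0 (a - c).
have := sqr_ge0 (b + d); have := sqr_ge0 (b - d).
by have := sqr_ge0 a; have := sqr_ge0 b; have := sqr_ge0 c; have := sqr_ge0 d; lra.
Qed.

(** [Rcomplex R] is the complex field with real scalars, which makes L^2 a submodule over R. *)
Definition mem_L2 : {pred (R * R -> Rcomplex R)} :=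
  fun f => `[< L2 (f : R * R -> R[i]) >].

Lemma mem_L2_submod : submod_closed mem_L2.
Proof.
split.
  apply/asboolP/L2P; split; [exact: measurable_cst|exact: measurable_cst|].
  rewrite (_ : EFin \o _ = cst 0%E); first exact: integrable0.
  by apply/funext => x /=; rewrite /rdot /= !mulr0 addr0.
move=> c f g /asboolP Lf /asboolP Lg; apply/asboolP.
have [rf jf If] := (L2P f).1 Lf; have [rg jg Ig] := (L2P g).1 Lg.
have Ifg := integrable_rdot Lf Lg.
have ReE x : Re ((c *: f + g) x) = c * Re (f x) + Re (g x).
  by rewrite -[(c *: f + g) x]/(c *: (f x : Rcomplex R) + g x); case: (f x) => ? ?; case: (g x).
have ImE x : Im ((c *: f + g) x) = c * Im (f x) + Im (g x).
  by rewrite -[(c *: f + g) x]/(c *: (f x : Rcomplex R) + g x); case: (f x) => ? ?; case: (g x).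
apply/L2P; split.
- rewrite (_ : (fun _ => _) = (fun x => c * Re (f x) + Re (g x))); last exact/funext.
  by apply: measurable_funD => //; apply: measurable_funM.
- rewrite (_ : (fun _ => _) = (fun x => c * Im (f x) + Im (g x))); last exact/funext.
  by apply: measurable_funD => //; apply: measurable_funM.
rewrite (_ : EFin \o _ = (fun x => (c ^+ 2)%:E * (EFin \o rdot f f) x +
    ((2 * c)%:E * (EFin \o rdot f g) x + (EFin \o rdot g g) x))%E).
  by do 2?[apply: integrableD => //]; exact: integrableZl.
apply/funext => x /=; rewrite -!EFinM -!EFinD; congr (_%:E).
by rewrite /rdot ReE ImE; ring.
Qed.
HB.instance Definition _ := GRing.isSubmodClosed.Build R _ mem_L2 mem_L2_submod.

Record L2fun := L2Fun { L2val :> R * R -> Rcomplex R ; L2valP : L2val \in mem_L2 }.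
HB.instance Definition _ := [isSub for L2val].
HB.instance Definition _ := [Choice of L2fun by <:].
HB.instance Definition _ := [SubChoice_isSubLmodule of L2fun by <:].

Lemma L2funP (u : L2fun) : L2 (u : R * R -> R[i]).
Proof. exact: asboolP (L2valP u). Qed.

(** Takes the default value 0 when f is not square integrable. *)
Definition mkL2 (f : R * R -> R[i]) : L2fun := insubd 0 (f : R * R -> Rcomplex R).

Lemma mkL2E f : L2 f -> (mkL2 f : R * R -> R[i]) = f.
Proof. by move=> Lf; rewrite /mkL2 /= (@insubdK _ _ L2fun) //; exact/asboolP. Qed.

Lemma L2fun_eq (u v : L2fun) : (u : R * R -> R[i]) = v -> u = v.
Proof. by move=> ?; exact: val_inj. Qed.

Lemma ReD (z w : R[i]) : Re (z + w) = Re z + Re w. Proof. by case: z w => ? ? []. Qed.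
Lemma ImD (z w : R[i]) : Im (z + w) = Im z + Im w. Proof. by case: z w => ? ? []. Qed.
Lemma ReN (z : R[i]) : Re (- z) = - Re z. Proof. by case: z. Qed.
Lemma ImN (z : R[i]) : Im (- z) = - Im z. Proof. by case: z. Qed.
Lemma ReZ (c : R) (z : Rcomplex R) : Re (c *: z) = c * Re z. Proof. by case: z. Qed.
Lemma ImZ (c : R) (z : Rcomplex R) : Im (c *: z) = c * Im z. Proof. by case: z. Qed.

Definition ipL2 (u v : L2fun) : R := L2ip u v.

Lemma ipL2_semi_inner : semi_inner ipL2.
Proof.
split.
- by move=> u v; apply: eq_Rintegral => x _; rewrite /rdot mulrC [X in _ + X]mulrC.
- move=> u v w; rewrite /ipL2 /L2ip -RintegralD //; try exact: integrable_rdot (L2funP _) (L2funP _).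
  apply: eq_Rintegral => x _; rewrite /rdot.
  by rewrite -[(u + v : L2fun) x]/(u x + v x) ReD ImD; ring.
- move=> c u w; rewrite /ipL2 /L2ip -RintegralZl //; try exact: integrable_rdot (L2funP _) (L2funP _).
  apply: eq_Rintegral => x _; rewrite /rdot.
  by rewrite -[(c *: u : L2fun) x]/(c *: (u x : Rcomplex R)) ReZ ImZ; ring.
- by move=> u; apply: Rintegral_ge0 => x _; exact: rdot_ge0.
Qed.

Lemma ipL2_sqr (u : L2fun) : (ipL2 u u)%:E = (\int[leb2]_x (rdot u u x)%:E)%E.
Proof.
rewrite /ipL2 /L2ip /Rintegral fineK //.
exact: integrable_fin_num (integrable_rdot (L2funP _) (L2funP _)).
Qed.

Lemma L2ip_ae f f' g : L2 f -> L2 f' -> L2 g -> eqL2 f f' -> L2ip f g = L2ip f' g.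
Proof.
move=> Lf Lf' Lg ff'; congr fine; apply: ae_eq_integral => //.
- by apply/measurable_EFinP; exact: measurable_rdot.
- by apply/measurable_EFinP; exact: measurable_rdot.
apply: (@filterS _ _ (ae_filter_ringOfSetsType leb2)) ff' => x ffx _.
by rewrite /= /rdot ffx.
Qed.

End L2space.

(** * Almost everywhere convergence of rapidly converging sequences *)

Section RieszFischer.
Context d {T : measurableType d} {R : realType} (mu : {measure set T -> \bar R}).

Let half_sum n : \sum_(k < n) 2^-1 ^+ k <= 2 :> R.
Proof.
have hs : \sum_(k < n) 2^-1 ^+ k = 2 - 2 * 2^-1 ^+ n :> R.
  elim: n => [|n IH]; first by rewrite big_ord0 expr0 mulr1 subrr.
  by rewrite big_ord_recr /= IH exprS; field.
have : 0 <= 2^-1 ^+ n :> R by rewrite exprn_ge0 // invr_ge0 ler0n.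
by rewrite hs; lra.
Qed.

(* The increments are summable pointwise since |t| <= 2 ^- k + 2 ^ k * t ^ 2. *)
Lemma ae_cvg_fast_L2 (w : nat -> T -> R) :
  (forall k, measurable_fun setT (w k)) ->
  (forall k, (\int[mu]_x ((w k.+1 x - w k x) ^+ 2)%:E <= ((4%:R ^- k)%:E : \bar R))%E) ->
  {ae mu, forall x, cvgn (w ^~ x)}.
Proof.
move=> mw hw.
(* The weight 2^k turns the bounds 4^-k into 2^-k, which are still summable, so the sum of the [g k]
   is finite almost everywhere. *)
pose g k x : \bar R := (2 ^+ k * (w k.+1 x - w k x) ^+ 2)%:E.
have g0 k x : (0 <= g k x)%E by rewrite lee_fin; apply: mulr_ge0; [exact: exprn_ge0|exact: sqr_ge0].
have md k : measurable_fun setT (fun x => (w k.+1 x - w k x) ^+ 2).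
  by apply: measurable_funX; exact: measurable_funB.
have mg k : measurable_fun setT (g k).
  by apply/measurable_EFinP; exact: measurable_funM.
have mG : measurable_fun setT (fun x => \sum_(k <oo) g k x)%E.
  by apply: ge0_emeasurable_sum => // k x _ _; exact: g0.
have intg k : (\int[mu]_x g k x <= (2^-1 ^+ k)%:E)%E.
  rewrite /g; under eq_integral do rewrite EFinM.
  have q0 x : setT x -> (0 <= ((w k.+1 x - w k x) ^+ 2)%:E)%E by rewrite lee_fin sqr_ge0.
  have p0 : (0 <= (2 ^+ k)%:E :> \bar R)%E by rewrite lee_fin exprn_ge0.
  rewrite (ge0_integralZl mu measurableT ((measurable_EFinP _ _).2 (md k)) q0 p0).
  apply: (le_trans (lee_wpmul2l _ (hw k))); first by rewrite lee_fin exprn_ge0.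
  rewrite -EFinM lee_fin -exprVn -exprMn.
  by rewrite (_ : 2 * 4^-1 = 2^-1 :> R) //; field.
have IG : mu.-integrable setT (fun x => \sum_(k <oo) g k x)%E.
  apply/integrableP; split => //.
  under eq_integral do rewrite gee0_abs ?nneseries_ge0 //.
  rewrite integral_nneseries //.
  apply: (@le_lt_trans _ _ 2%:E); last exact: ltry.
  apply: lime_le; first by apply: is_cvg_nneseries => k _ _; exact: integral_ge0.
  apply: nearW => n; rewrite big_mkord.
  apply: (@le_trans _ _ (\sum_(k < n) (2^-1 ^+ k)%:E)%E); first exact: lee_sum.
  by rewrite sumEFin lee_fin half_sum.
apply: (@filterS _ _ (ae_filter_ringOfSetsType mu)) (integrable_ae measurableT IG).
move=> x /(_ I) Gfin.
pose dd k := w k.+1 x - w k x.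
have cv : cvgn [normed series dd].
  apply: nondecreasing_is_cvgn.
    by apply: nondecreasing_series => k _ _; exact: normr_ge0.
  exists (2 + fine (\sum_(k <oo) g k x)%E) => _ [n _ <-] /=.
  rewrite /series /= big_mkord.
  apply: (@le_trans _ _ (\sum_(k < n) (2^-1 ^+ k + 2 ^+ k * dd k ^+ 2))).
    apply: ler_sum => k _.
    have a0 : 0 < 2 ^+ k :> R by rewrite exprn_gt0.
    have b0 : 0 <= 2^-1 ^+ k :> R by rewrite exprn_ge0 // invr_ge0 ler0n.
    have ab : 2 ^+ k * 2^-1 ^+ k = 1 :> R by rewrite -exprMn divff ?expr1n // pnatr_eq0.
    (* Expanding 2^k (|t| - 2^-k / 2)^2 >= 0 gives |t| <= 2^-k / 4 + 2^k t^2. *)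
    have := mulr_ge0 (ltW a0) (sqr_ge0 (`|dd k| - 2^-1 ^+ k / 2)).
    rewrite -(real_normK (num_real (dd k))).
    move: (`|dd k|) (2 ^+ k) (2^-1 ^+ k) ab b0 {a0} => t a b ab b0.
    rewrite (_ : a * _ = a * t ^+ 2 - (a * b) * t + (a * b) * b / 4); last by field.
    by rewrite ab; lra.
  rewrite big_split; apply: lerD; first exact: half_sum.
  rewrite -lee_fin fineK // -sumEFin.
  apply: le_trans (@nneseries_lim_ge _ (fun k => g k x) xpredT 0 n _) => [|k _ _]; last exact: g0.
  by rewrite big_mkord.
have /cvg_ex[l hl] := normed_cvg cv.
have sE : series dd = [sequence w n x - w 0%N x]_n by exact: (telescopeK (fun n => w n x)).
move: hl; rewrite sE => hl; apply/cvg_ex; exists (l + w 0%N x).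
rewrite (_ : w ^~ x = (fun n => (w n x - w 0%N x) + w 0%N x)).
  by apply: cvgD => //; exact: cvg_cst.
by apply/funext => n; rewrite subrK.
Qed.

End RieszFischer.

(** * Completeness of L^2 *)

Section L2complete.
Context {R : realType}.
Local Notation plane := (measurableTypeR R * measurableTypeR R)%type.
Local Notation Re := (@complex.Re R).
Local Notation Im := (@complex.Im R).
Local Notation leb2 := (@leb2 R).

(** Fatou's lemma, the pointwise limit being the lower limit almost everywhere. *)
Lemma fatou_bound (f : nat -> plane -> R) (h : plane -> R) (c : R) :
  (forall n, measurable_fun setT (f n)) -> measurable_fun setT h ->
  (forall n x, 0 <= f n x) -> (forall x, 0 <= h x) ->
  {ae leb2, forall x, (fun n => f n x) @ \oo --> h x} ->
  (forall n, (\int[leb2]_x (f n x)%:E <= c%:E)%E) ->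
  (\int[leb2]_x (h x)%:E <= c%:E)%E.
Proof.
move=> mf mh f0 h0 fh fc.
have mF n : measurable_fun setT (EFin \o f n) by apply/measurable_EFinP.
rewrite (_ : (\int[leb2]_x (h x)%:E = \int[leb2]_x limn_einf (fun n => (f n x)%:E))%E).
  apply: (le_trans (@fatou _ _ _ leb2 setT measurableT (fun n => EFin \o f n) mF _)).
    by move=> n x _; rewrite lee_fin.
  rewrite limn_einf_lim; apply: lime_le; first exact: is_cvg_einfs.
  apply: nearW => n; apply: le_trans (fc n).
  by apply: ereal_inf_lbound; exists n => /=.
apply: ge0_ae_eq_integral => //.
- exact/measurable_EFinP.
- rewrite /limn_einf; apply: measurableT_comp => //.
  apply: (@measurable_fun_limn_esup _ _ _ _ (fun n x => - (f n x)%:E)%E) => n.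
  by apply: (measurableT_comp (f := -%E)) => //; exact: mF.
- by move=> x _; rewrite lee_fin.
- move=> x _; rewrite limn_einf_lim; apply: lime_ge; first exact: is_cvg_einfs.
  apply: nearW => n; apply: le_ereal_inf_tmp => _ [k _ <-] /=.
  by rewrite lee_fin.
apply: (@filterS _ _ (ae_filter_ringOfSetsType leb2)) fh => x fhx _.
have /cvg_limn_einf_sup[-> _] // : (fun n => (f n x)%:E) @ \oo --> (h x)%:E.
by apply: cvg_EFin => //; exact: nearW.
Qed.

Lemma ipL2_complete : ip_complete (@ipL2 R).
Proof.
move=> u cau.
have p4 k : 0 < 4 ^- k :> R by rewrite invr_gt0 exprn_gt0.
have [N hN] := choice (fun k => cau _ (p4 k)).
(* Running maxima make the indices of the subsequence monotone. *)
pose n k := (\max_(i < k.+1) N i)%N.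
have nN k : (N k <= n k)%N by rewrite /n big_ord_recr leq_maxr.
have n1 k : (n k <= n k.+1)%N by rewrite [leqRHS]/n big_ord_recr leq_maxl.
have nS k j : (n k <= n (j + k)%N)%N.
  by elim: j => // j IH; apply: leq_trans IH _; rewrite addSn n1.
pose w k := u (n k).
have wc k : ipL2 (w k.+1 - w k) (w k.+1 - w k) < 4 ^- k.
  by apply: hN => //; exact: leq_trans (n1 k).
have mRe (f : L2fun) : measurable_fun setT ((fun x => Re (f x)) : plane -> R).
  by have [] := L2funP f.
have mIm (f : L2fun) : measurable_fun setT ((fun x => Im (f x)) : plane -> R).
  by have [] := L2funP f.
have part (p : R[i] -> R) : (forall z z' : R[i], p (z + z') = p z + p z') ->
    (forall z : R[i], p (- z) = - p z) ->
    (forall z : R[i], p z ^+ 2 <= Re z * Re z + Im z * Im z) ->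
    (forall f : L2fun, measurable_fun setT ((fun x => p (f x)) : plane -> R)) ->
    exists2 l : plane -> R, measurable_fun setT l &
      {ae leb2, forall x, (fun k => p (w k x)) @ \oo --> l x}.
  move=> pD pN psq mp.
  (* The upper limit is measurable and defined everywhere; it is the limit wherever the sequence
     converges. *)
  exists (fun x => fine (limn_esup (fun k => (p (w k x))%:E))).
    apply: measurableT_comp => //.
    apply: (@measurable_fun_limn_esup _ _ _ _ (fun k x => (p (w k x))%:E)) => k.
    by apply/measurable_EFinP; exact: mp.
  have := @ae_cvg_fast_L2 _ plane R leb2 (fun k x => p (w k x)) (fun k => mp (w k)).
  have wk k : (\int[leb2]_x ((p (w k.+1 x) - p (w k x)) ^+ 2)%:E <= (4 ^- k)%:E)%E.
    apply: le_trans (_ : (ipL2 (w k.+1 - w k) (w k.+1 - w k))%:E <= _)%E; last first.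
      by rewrite lee_fin ltW.
    rewrite ipL2_sqr; apply: ge0_le_integral => //.
    - by move=> x _; rewrite lee_fin sqr_ge0.
    - by apply/measurable_EFinP; apply: measurable_funX; exact: measurable_funB.
    - by apply/measurable_EFinP; apply: measurable_rdot; exact: L2funP.
    - move=> x _; rewrite lee_fin /rdot -pN -pD.
      exact: psq (w k.+1 x - w k x).
  move=> /(_ wk).
  apply: (@filterS _ _ (ae_filter_ringOfSetsType leb2)) => x /cvg_ex[l hl].
  have /cvg_limn_einf_sup[_ ->] // : (fun k => (p (w k x))%:E) @ \oo --> l%:E.
  by apply: cvg_EFin => //; exact: nearW.
have [lr mlr hlr] : exists2 l : plane -> R, measurable_fun setT l &
      {ae leb2, forall x, (fun k => Re (w k x)) @ \oo --> l x}.
  apply: part => //; [exact: ReD|exact: ReN|].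
  by move=> z; rewrite expr2 lerDl -expr2 sqr_ge0.
have [li mli hli] : exists2 l : plane -> R, measurable_fun setT l &
      {ae leb2, forall x, (fun k => Im (w k x)) @ \oo --> l x}.
  apply: part => //; [exact: ImD|exact: ImN|].
  by move=> z; rewrite expr2 lerDr -expr2 sqr_ge0.
pose l (x : R * R) : R[i] := Complex (lr x) (li x).
(* Fatou along the subsequence passes the Cauchy estimate for |u m - w k| to the limit l. *)
have bnd j m : (N j <= m)%N ->
    (\int[leb2]_x (rdot (fun y => u m y - l y) (fun y => u m y - l y) x)%:E <= (4 ^- j)%:E)%E.
  move=> jm.
  apply: (@fatou_bound (fun k => rdot (u m - w (k + j)%N : L2fun) (u m - w (k + j)%N : L2fun))).
  - by move=> k; apply: measurable_rdot; exact: L2funP.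
  - rewrite (_ : rdot _ _ = (fun x => (Re (u m x) - lr x) * (Re (u m x) - lr x) +
        (Im (u m x) - li x) * (Im (u m x) - li x))); last first.
      by apply/funext => x; rewrite /rdot !ReD !ImD !ReN !ImN.
    by apply: measurable_funD; apply: measurable_funM; apply: measurable_funB.
  - by move=> k x; exact: rdot_ge0.
  - by move=> x; exact: rdot_ge0.
  - have both := @filterI _ _ (ae_filter_ringOfSetsType leb2) _ _ hlr hli.
    apply: (@filterS _ _ (ae_filter_ringOfSetsType leb2)) both => x [cr ci].
    rewrite /rdot !ReD !ImD !ReN !ImN.
    rewrite (_ : (fun _ => _) = (fun k =>
       (Re (u m x) - Re (w (k + j)%N x)) * (Re (u m x) - Re (w (k + j)%N x)) +
       (Im (u m x) - Im (w (k + j)%N x)) * (Im (u m x) - Im (w (k + j)%N x)))); last first.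
      apply/funext => k.
      by rewrite -[(u m - w (k + j)%N : L2fun) x]/(u m x - w (k + j)%N x) ReD ImD ReN ImN.
    have cr' : (fun k => Re (u m x) - Re (w (k + j)%N x)) @ \oo --> Re (u m x) - lr x.
      by apply: cvgB; [exact: cvg_cst|exact: (cvg_comp _ _ (cvg_addnr j) cr)].
    have ci' : (fun k => Im (u m x) - Im (w (k + j)%N x)) @ \oo --> Im (u m x) - li x.
      by apply: cvgB; [exact: cvg_cst|exact: (cvg_comp _ _ (cvg_addnr j) ci)].
    by apply: cvgD; apply: cvgM.
  - move=> k; rewrite -ipL2_sqr lee_fin ltW // hN //.
    exact: leq_trans (nN j) (nS j k).
have Ld : L2 (fun y => u (N 0%N) y - l y).
  split.
  - rewrite (_ : (fun _ => _) = (fun x => Re (u (N 0%N) x) - lr x)).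
      exact: measurable_funB.
    by apply/funext => x; rewrite ReD ReN.
  - rewrite (_ : (fun _ => _) = (fun x => Im (u (N 0%N) x) - li x)).
      exact: measurable_funB.
    by apply/funext => x; rewrite ImD ImN.
  apply/L2norm_lty; apply: le_lt_trans (bnd 0%N _ (leqnn _)) _.
  exact: ltry.
(* Square integrability is known for the difference u - l, so l itself is recovered by
   subtraction. *)
pose L : L2fun := u (N 0%N) - mkL2 (fun y => u (N 0%N) y - l y).
have LE : (L : R * R -> R[i]) = l.
  apply/funext => x; rewrite -[LHS]/(u (N 0%N) x - mkL2 (fun y => u (N 0%N) y - l y) x).
  by rewrite mkL2E // opprB addrC subrK.
exists L; apply/(vlimP (@ipL2_semi_inner R)) => e e0.
have [j je] : exists j, 4 ^- j < e.
  have : (fun j => (4^-1 : R) ^+ j) @ \oo --> (0 : R).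
    by apply: cvg_expr; rewrite ger0_norm ?invr_ge0 // invf_lt1 // ltr1n.
  move=> /cvgrPdist_lt /(_ e e0)[j _ /(_ j (leqnn j))] /=.
  rewrite sub0r normrN exprVn => h; exists j; apply: le_lt_trans h; exact: ler_norm.
exists (N j) => // m /= jm; apply: le_lt_trans je.
rewrite -lee_fin ipL2_sqr; apply: le_trans (bnd _ _ jm).
rewrite (_ : (u m - L : R * R -> R[i]) = (fun y => u m y - l y)) //.
by apply/funext => x; rewrite -[LHS]/(u m x - L x) LE.
Qed.

End L2complete.

(** * Smooth functions on the plane *)

Section SmoothCalculus.
Context {R : realType}.
Implicit Types (u v w : R * R -> R) (j : 'I_2) (x : R * R).

(** Coinduction: smoothness is the largest property that implies differentiability and passes to
    partial derivatives. *)
Lemma smooth_coind (S : (R * R -> R) -> Prop) :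
  (forall u, S u -> (forall x, differentiable u x) /\ forall j, S (partial j u)) ->
  forall u, S u -> smooth u.
Proof.
move=> hS u Su s x; suff : S (foldr partial u s) by move=> /hS[].
by elim: s => //= j s /hS[_]; exact.
Qed.

Lemma smooth_differentiable u x : smooth u -> differentiable u x.
Proof. by move=> /(_ [::] x). Qed.

Lemma smooth_partial j u : smooth u -> smooth (partial j u).
Proof. by move=> su s x; have := su (rcons s j) x; rewrite foldr_rcons. Qed.

Lemma smooth_continuous u : smooth u -> continuous u.
Proof. by move=> su x; exact/differentiable_continuous/smooth_differentiable. Qed.

Lemma partialD j u v x : differentiable u x -> differentiable v x ->
  partial j (fun y => u y + v y) x = partial j u x + partial j v x.
Proof. by move=> du dv; rewrite /partial -[LHS]/('D_ _ (u + v) x) deriveD //;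
  exact: diff_derivable. Qed.

Lemma partialZ j c u x : differentiable u x ->
  partial j (fun y => c * u y) x = c * partial j u x.
Proof. by move=> du; rewrite /partial -[LHS]/('D_ _ (c *: u) x) deriveZ //; exact: diff_derivable. Qed.

Lemma partialM j u v x : differentiable u x -> differentiable v x ->
  partial j (fun y => u y * v y) x = u x * partial j v x + v x * partial j u x.
Proof. by move=> du dv; rewrite /partial -[LHS]/('D_ _ (u * v) x) deriveM //; exact: diff_derivable. Qed.

Definition coord j x : R := if j == 0 then x.1 else x.2.

Lemma I2P j : j = 0 \/ j = 1.
Proof. by case: j => [[|[|]]] // ?; [left|right]; exact: val_inj. Qed.

Lemma coord0 : coord 0 = fst. Proof. exact: funext. Qed.
Lemma coord1 : coord 1 = snd. Proof. exact: funext. Qed.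

Lemma fst_continuous : continuous (fst : R * R -> R).
Proof. by move=> x; exact: cvg_fst. Qed.

Lemma snd_continuous : continuous (snd : R * R -> R).
Proof. by move=> x; exact: cvg_snd. Qed.

Lemma differentiable_coord j x : differentiable (coord j) x.
Proof.
have [->|->] := I2P j; rewrite (coord0, coord1); apply: linear_differentiable.
  exact: fst_continuous.
exact: snd_continuous.
Qed.

Lemma partial_coord j k x : partial j (coord k) x = (j == k)%:R.
Proof.
rewrite /partial deriveE; last exact: differentiable_coord.
have [->|->] := I2P k; rewrite (coord0, coord1) diff_lin;
  (try exact: fst_continuous); (try exact: snd_continuous);
  by have [->|->] := I2P j.
Qed.

Lemma smoothD u v : smooth u -> smooth v -> smooth (fun x => u x + v x).
Proof.
move=> su sv; apply: (@smooth_coind (fun w => exists u v,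
  [/\ smooth u, smooth v & w = fun x => u x + v x])); last by exists u, v.
move=> _ [a [b [sa sb ->]]]; split => [x|j].
  by apply: differentiableD; exact: smooth_differentiable.
exists (partial j a), (partial j b); split; try exact: smooth_partial.
by apply/funext => x; rewrite partialD //; exact: smooth_differentiable.
Qed.

Lemma smoothZ c u : smooth u -> smooth (fun x => c * u x).
Proof.
move=> su; apply: (@smooth_coind (fun w => exists2 u, smooth u & w = fun x => c * u x)); last by exists u.
move=> _ [a sa ->]; split => [x|j].
  by apply: differentiableZ; exact: smooth_differentiable.
exists (partial j a); first exact: smooth_partial.
by apply/funext => x; rewrite partialZ //; exact: smooth_differentiable.
Qed.

(** Products x_k v alone are not stable under differentiation, since a term v appears; sums u + x_k
    v are. *)
Lemma smooth_coordM k u : smooth u -> smooth (fun x => coord k x * u x).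
Proof.
move=> su; apply: (@smooth_coind (fun w => exists u v,
  [/\ smooth u, smooth v & w = fun x => u x + coord k x * v x])); last first.
  exists (fun x => 0 * u x), u; split => //; first exact: smoothZ.
  by apply/funext => x; rewrite mul0r add0r.
move=> _ [a [b [sa sb ->]]].
have db x := smooth_differentiable x sb.
have dc x := differentiable_coord k x.
have dcb x : differentiable (fun y => coord k y * b y) x by exact: differentiableM.
split => [x|j]; first by apply: differentiableD => //; exact: smooth_differentiable.
exists (fun x => partial j a x + (j == k)%:R * b x), (partial j b); split.
- by apply: smoothD; [exact: smooth_partial|exact: smoothZ].
- exact: smooth_partial.
apply/funext => x; rewrite partialD //; last exact: smooth_differentiable.
by rewrite partialM // partial_coord; ring.
Qed.

Lemma slice0 u (x y : R) : differentiable u (x, y) ->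
  is_derive x 1 (fun t => u (t, y)) (partial 0 u (x, y)).
Proof.
move=> /(@diff_derivable _ _ _ _ _ ((1, 0) : R * R)) du.
have e : (fun h : R => h^-1 *: (((fun t => u (t, y)) \o shift x) (h *: 1) - u (x, y))) =
    (fun h : R => h^-1 *: ((u \o shift (x, y)) (h *: ((1, 0) : R * R)) - u (x, y))).
  apply/funext => h /=; congr (_ *: (u _ - _)).
  by congr (_, _); rewrite /= scaler0 add0r.
by split; [rewrite /derivable e|rewrite /partial /= /derive e].
Qed.

Lemma slice1 u (x y : R) : differentiable u (x, y) ->
  is_derive y 1 (fun t => u (x, t)) (partial 1 u (x, y)).
Proof.
move=> /(@diff_derivable _ _ _ _ _ ((0, 1) : R * R)) du.
have e : (fun h : R => h^-1 *: (((fun t => u (x, t)) \o shift y) (h *: 1) - u (x, y))) =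
    (fun h : R => h^-1 *: ((u \o shift (x, y)) (h *: ((0, 1) : R * R)) - u (x, y))).
  apply/funext => h /=; congr (_ *: (u _ - _)).
  by congr (_, _); rewrite /= scaler0 add0r.
by split; [rewrite /derivable e|rewrite /partial /= /derive e].
Qed.

End SmoothCalculus.

(** * Symmetry of second partial derivatives *)

Section Schwarz.
Context {R : realType}.
Implicit Types (u : R * R -> R).

Definition rect_diff u (a b h : R) := u (a + h, b + h) - u (a + h, b) - (u (a, b + h) - u (a, b)).

(** The second difference is the increment in s of u(s, b + h) - u(s, b), so one mean value theorem
    per variable produces a mixed derivative. Exchanging the variables, as in [rect_diff10],
    produces the other one. *)
Lemma rect_diff01 u (a b h : R) : smooth u -> 0 < h ->
  exists p q : R, [/\ a < p < a + h, b < q < b + h &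
    rect_diff u a b h = partial 1 (partial 0 u) (p, q) * h * h].
Proof.
move=> su h0.
have dv (s y : R) : is_derive s 1 (fun t => u (t, y)) (partial 0 u (s, y)).
  exact/slice0/smooth_differentiable.
have d2 (s y : R) : is_derive s 1 (fun t => partial 0 u (y, t)) (partial 1 (partial 0 u) (y, s)).
  exact/slice1/smooth_differentiable/smooth_partial.
have dphi (s : R) : is_derive s 1 (fun t => u (t, b + h) - u (t, b))
    (partial 0 u (s, b + h) - partial 0 u (s, b)) by exact: is_deriveB.
have ah : a < a + h by rewrite ltrDl.
have bh : b < b + h by rewrite ltrDl.
have [|p pin e1] := MVT ah (fun s _ => dphi s).
  apply: derivable_within_continuous => s _; exact: ex_derive.
have [|q qin e2] := MVT bh (fun s _ => d2 s p).
  apply: derivable_within_continuous => s _; exact: ex_derive.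
move: pin qin; rewrite !in_itv /= => pin qin.
exists p, q; split => //.
rewrite /rect_diff e1 e2.
by rewrite !(addrC _ h) !addrK.
Qed.

Lemma rect_diff10 u (a b h : R) : smooth u -> 0 < h ->
  exists p q : R, [/\ a < p < a + h, b < q < b + h &
    rect_diff u a b h = partial 0 (partial 1 u) (p, q) * h * h].
Proof.
move=> su h0.
have dv (s y : R) : is_derive s 1 (fun t => u (y, t)) (partial 1 u (y, s)).
  exact/slice1/smooth_differentiable.
have d2 (s y : R) : is_derive s 1 (fun t => partial 1 u (t, y)) (partial 0 (partial 1 u) (s, y)).
  exact/slice0/smooth_differentiable/smooth_partial.
have dphi (s : R) : is_derive s 1 (fun t => u (a + h, t) - u (a, t))
    (partial 1 u (a + h, s) - partial 1 u (a, s)) by exact: is_deriveB.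
have ah : a < a + h by rewrite ltrDl.
have bh : b < b + h by rewrite ltrDl.
have [|q qin e1] := MVT bh (fun s _ => dphi s).
  apply: derivable_within_continuous => s _; exact: ex_derive.
have [|p pin e2] := MVT ah (fun s _ => d2 s q).
  apply: derivable_within_continuous => s _; exact: ex_derive.
move: pin qin; rewrite !in_itv /= => pin qin.
exists p, q; split => //.
have -> : rect_diff u a b h = u (a + h, b + h) - u (a, b + h) - (u (a + h, b) - u (a, b)).
  by rewrite /rect_diff; ring.
rewrite e1 e2.
by rewrite !(addrC _ h) !addrK.
Qed.

(** The two mixed derivatives coincide at a pair of points of any small square at (a, b); continuity
    brings both values to (a, b). *)
Lemma partial_comm u (x : R * R) : smooth u ->
  partial 0 (partial 1 u) x = partial 1 (partial 0 u) x.
Proof.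
move=> su; case: x => a b; set f := partial 0 _; set g := partial 1 (partial 0 u).
have cf : {for (a, b), continuous f} by apply: smooth_continuous; do 2 apply: smooth_partial.
have cg : {for (a, b), continuous g} by apply: smooth_continuous; do 2 apply: smooth_partial.
apply/eqP; rewrite -subr_eq0 -normr_le0; apply/ler_addgt0Pr => e e0; rewrite add0r.
have e2 : 0 < e / 2 by rewrite divr_gt0.
move/cvgrPdist_lt : cf => /(_ _ e2) nf; move/cvgrPdist_lt : cg => /(_ _ e2) ng.
have [d /= d0 hd] := (nbhs_ballP _ _).1 (filterI nf ng).
have close (p q : R) : a < p < a + d -> b < q < b + d ->
    `|f (a, b) - f (p, q)| < e / 2 /\ `|g (a, b) - g (p, q)| < e / 2.
  move=> /andP[p1 p2] /andP[q1 q2]; apply: hd; split => /=.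
    by rewrite /ball /= ltr_norml; apply/andP; split; lra.
  by rewrite /ball /= ltr_norml; apply/andP; split; lra.
have [p [q [hp hq e1]]] := rect_diff10 a b su d0.
have [p' [q' [hp' hq' e3]]] := rect_diff01 a b su d0.
have eqfg : f (p, q) = g (p', q').
  have dn := lt0r_neq0 d0.
  exact: (mulIf dn (mulIf dn (etrans (esym e1) e3))).
have [h1 _] := close _ _ hp hq; have [_ h2] := close _ _ hp' hq'.
rewrite eqfg in h1.
move: (f (a, b)) (g (a, b)) (g (p', q')) h1 h2 => x y z h1 h2.
have -> : x - y = (x - z) - (y - z) by ring.
by apply: (le_trans (ler_normB _ _)); apply: ltW; rewrite (splitr e); exact: ltrD.
Qed.

End Schwarz.

(** * Measurability and integration of functions supported in a square *)

Section BoxSupport.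
Context {R : realType}.
Local Notation plane := (measurableTypeR R * measurableTypeR R)%type.
Implicit Types (u v w : R * R -> R) (j : 'I_2).

(** The plane carries the product sigma-algebra, so an open set is written as a countable union of
    rational squares. *)
Lemma open_measurable_plane (U : set (R * R)) : open U -> measurable (U : set plane).
Proof.
move=> oU.
pose b (p : rat * rat * nat) : set (R * R) :=
  ball (ratr p.1.1 : R) p.2.+1%:R^-1 `*` ball (ratr p.1.2 : R) p.2.+1%:R^-1.
have -> : U = \bigcup_p (if `[< b p `<=` U >] then b p else set0).
  apply/seteqP; split; last first.
    by move=> x [p _]; case: ifP => // /asboolP; exact.
  move=> x Ux; have [e /= e0 eU] := (nbhs_ballP _ _).1 (open_nbhs_nbhs (conj oU Ux)).
  have [n ne] : exists n, n.+1%:R^-1 < e / 2.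
    have e2 : 0 < e / 2 by rewrite divr_gt0.
    move/cvgrPdist_lt : (@cvg_harmonic R) => /(_ _ e2)[n _ /(_ n (leqnn n))] /=.
    by rewrite sub0r normrN => h; exists n; apply: le_lt_trans h; exact: ler_norm.
  have n0 : 0 < n.+1%:R^-1 :> R by rewrite invr_gt0.
  have app (c t : R) : 0 < c -> exists q : rat, `|ratr q - t| < c.
    move=> c0; have [|q] := @rat_in_itvoo R (t - c) (t + c); first by lra.
    by rewrite in_itv /= => /andP[q1 q2]; exists q; rewrite ltr_norml; apply/andP; split; lra.
  have [q1 h1] := app _ x.1 n0; have [q2 h2] := app _ x.2 n0.
  exists (q1, q2, n) => //; case: ifP => [_|/asboolP []]; first by split.
  have tri (c q t z : R) : c < e / 2 -> `|q - t| < c -> `|q - z| < c -> `|t - z| < e.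
    move=> ce h h'; apply: (le_lt_trans (ler_distD q _ _)).
    by rewrite (distrC t) (splitr e) ltrD // (lt_trans _ ce).
  by move=> y [y1 y2]; apply: eU; split; [exact: tri ne h1 y1|exact: tri ne h2 y2].
apply: countable_bigcupT_measurable => [|p]; first exact: countableP.
case: ifP => // _.
by apply: measurableX; exact: measurable_ball.
Qed.

Lemma continuous_measurable_plane u : continuous u -> measurable_fun setT (u : plane -> R).
Proof.
move=> /continuousP cu; apply: (measurability _ (RGenOpens.measurableE R)).
move=> _ [_ [a [b ->] <-]]; rewrite setTI; apply: open_measurable_plane.
exact/cu/interval_open.
Qed.

Definition box_support (M : R) u : Prop :=
  forall x, (M < `|x.1|) || (M < `|x.2|) -> u x = 0.

(** The region outside the square is open, so u vanishes near each of its points. *)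
Lemma box_support_partial M j u : box_support M u -> box_support M (partial j u).
Proof.
move=> hu x Mx; rewrite /partial (@near_eq_derive _ _ _ u (cst 0)) ?derive_cst //.
have cn1 : {for x, continuous (fun y : R * R => `|y.1|)}.
  by apply: continuous_comp; [exact: fst_continuous|exact: norm_continuous].
have cn2 : {for x, continuous (fun y : R * R => `|y.2|)}.
  by apply: continuous_comp; [exact: snd_continuous|exact: norm_continuous].
case/orP: Mx => Mx.
  have h : \forall y \near x, M < `|y.1| by exact: (cvgr_gt _ cn1).
  by apply: filterS h => y My; apply: hu; rewrite My.
have h : \forall y \near x, M < `|y.2| by exact: (cvgr_gt _ cn2).
by apply: filterS h => y My; apply: hu; rewrite My orbT.
Qed.

Lemma box_support_integrable M u : continuous u -> box_support M u ->
  leb2.-integrable setT (EFin \o u).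
Proof.
move=> cu hu.
pose A : set plane := `[- M, M]%classic `*` `[- M, M]%classic.
have mA : measurable A by apply: measurableX; exact: measurable_itv.
have -> : EFin \o u = (EFin \o u) \_ A.
  apply/funext => x; rewrite patchE; case: ifPn => // xA /=; rewrite hu //.
  apply: contraNT xA; rewrite negb_or -!leNgt !ler_norml => /andP[h1 h2].
  by rewrite inE; split; rewrite /= in_itv.
apply/(integrable_mkcond _ mA).
apply: measurable_bounded_integrable => //.
- have -> : leb2 A =
      (@lebesgue_measure R `[(- M)%R, M]%classic * @lebesgue_measure R `[(- M)%R, M]%classic)%E.
    exact: (@product_measure1E _ _ _ _ R lebesgue_measure lebesgue_measure
      `[- M, M] `[- M, M] (measurable_itv _) (measurable_itv _)).
  by rewrite lebesgue_measure_itv /=; case: ifP => _; rewrite -?EFinB -?EFinM ?mul0e ?ltry.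
- by apply: measurable_funTS; exact: continuous_measurable_plane.
have cA : compact (A : set (R * R)) by apply: compact_setX; exact: segment_compact.
have := compact_bounded (continuous_compact (continuous_subspaceT cu) cA).
move=> [N [rN hN]]; exists N; split => // y Ny x Ax; apply: hN => //.
Qed.

Lemma integral_derive_compact (M : R) (F f : R -> R) :
  (forall t : R, is_derive t (1 : R) F (f t)) -> continuous f ->
  (forall t : R, M < `|t| -> F t = 0) -> (forall t : R, M < `|t| -> f t = 0) ->
  (\int[lebesgue_measure]_t (f t)%:E = 0)%E.
Proof.
move=> dF cf F0 f0.
(* N is positive and exceeds M whatever the sign of M, so F vanishes at both endpoints. *)
pose N : R := `|M| + 1.
have MN : M < N by rewrite /N ltr_pwDr // ler_norm.
have N0 : 0 < N by rewrite /N ltr_wpDl.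
have NN : - N < N by rewrite gtrN.
rewrite (_ : (fun t => _) = (EFin \o f) \_ `[- N, N]); last first.
  apply/funext => t; rewrite patchE; case: ifPn => // tN.
  rewrite f0 //; apply: (lt_le_trans MN).
  rewrite leNgt; apply: contra tN; rewrite ltr_norml inE /= in_itv /= => /andP[h1 h2].
  by rewrite !ltW.
rewrite -integral_mkcond.
have cF t : {for t, continuous F}.
  by apply/differentiable_continuous/derivable1_diffP; exact: ex_derive.
have LR : derivable_oo_LRcontinuous F (- N) N.
  split; first by move=> t _; exact: ex_derive.
  - by apply: cvg_at_right_filter; exact: cF.
  - by apply: cvg_at_left_filter; exact: cF.
have Ff : {in `]- N, N[, derive1 F =1 f}.
  by move=> t _; rewrite derive1E; exact: derive_val.
rewrite (@continuous_FTC2 _ f F (- N) N NN (continuous_subspaceT cf) LR Ff).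
by rewrite !F0 ?subee // ?normrN gtr0_norm.
Qed.

(** Fubini, integrating first along the direction of the derivative. *)
Lemma integral_partial M j u : (forall x, differentiable u x) ->
  continuous (partial j u) -> box_support M u ->
  (\int[leb2]_x (partial j u x)%:E = 0)%E.
Proof.
move=> du cp hu; have hp := box_support_partial j hu.
have ip := box_support_integrable cp hp.
have [j0|j1] := I2P j; rewrite ?j0 ?j1 in cp hp ip *.
  rewrite /leb2 -(integral21_prod_meas1 ip) integral0_eq // => y _.
  apply: (@integral_derive_compact M (fun t => u (t, y))) => [t||t Mt|t Mt].
  - exact: slice0.
  - move=> t; apply: (cvg_comp (fun s : R => (s, y)) (partial 0 u) _ (cp (t, y))).
    exact: (@cvg_pair R R R (nbhs t) (nbhs t) (nbhs y) _ _ _ idfun (cst y) cvg_id (cvg_cst y)).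
  - by apply: hu; rewrite Mt.
  - by apply: hp; rewrite Mt.
rewrite /leb2 -(integral12_prod_meas1 ip) integral0_eq // => x _.
apply: (@integral_derive_compact M (fun t => u (x, t))) => [t||t Mt|t Mt].
- exact: slice1.
- move=> t; apply: (cvg_comp (fun s : R => (x, s)) (partial 1 u) _ (cp (x, t))).
  exact: (@cvg_pair R R R (nbhs t) (nbhs x) (nbhs t) _ _ _ (cst x) idfun (cvg_cst x) cvg_id).
- by apply: hu; rewrite /= Mt orbT.
- by apply: hp; rewrite /= Mt orbT.
Qed.

End BoxSupport.

(** * Test functions *)

Section TestFunctions.
Context {R : realType}.
Local Notation plane := (measurableTypeR R * measurableTypeR R)%type.
Local Notation Re := (@complex.Re R).
Local Notation Im := (@complex.Im R).
Implicit Types (phi psi : R * R -> R[i]) (j : 'I_2) (B : R).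

Local Notation ReF phi := (fun x : R * R => Re (phi x)).
Local Notation ImF phi := (fun x : R * R => Im (phi x)).
Local Notation supp phi := (closure [set x : R * R | phi x != 0]).

Lemma Re_smooth phi : test_function phi -> smooth (ReF phi). Proof. by case. Qed.
Lemma Im_smooth phi : test_function phi -> smooth (ImF phi). Proof. by case. Qed.

Lemma complex_ext (z w : R[i]) : Re z = Re w -> Im z = Im w -> z = w.
Proof. by case: z w => ? ? [? ?] /= -> ->. Qed.

Lemma supp_eq0 phi x : ~ supp phi x -> phi x = 0.
Proof. by move=> nx; apply/eqP; apply: contra_notT nx => x0; exact: subset_closure. Qed.

Lemma compact_supp (K : set (R * R)) phi : compact K -> closed K ->
  (forall x, ~ K x -> phi x = 0) -> compact (supp phi).
Proof.
move=> cK clK hK; apply: (subclosed_compact (@closed_closure _ _) cK).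
rewrite [X in _ `<=` X]((closure_id K).1 clK).
apply: closureS => x /= x0; apply: contrapT => nK.
by move: x0; rewrite hK // eqxx.
Qed.

Lemma partial_supp phi (p : R[i] -> R) j x : p 0 = 0 -> ~ supp phi x ->
  partial j (fun y => p (phi y)) x = 0.
Proof.
move=> p0 nx; rewrite /partial (@near_eq_derive _ _ _ _ (cst 0)) ?derive_cst //.
have : nbhs x (~` supp phi).
  by apply: open_nbhs_nbhs; split => //; apply: closed_openC; exact: closed_closure.
by apply: filterS => y ny; rewrite (supp_eq0 ny).
Qed.

Lemma test_function_box phi : test_function phi ->
  exists M : R, forall x : R * R, (M < `|x.1|) || (M < `|x.2|) -> phi x = 0.
Proof.
move=> [_ _ /compact_bounded[N [_ hN]]]; exists (`|N| + 1) => x xM.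
apply: supp_eq0 => sx.
have := hN (`|N| + 1); rewrite ltr_pwDr ?ler_norm // => /(_ isT x sx).
rewrite /= prod_normE ge_max => /andP[h1 h2].
by move: xM; rewrite !ltNge h1 h2.
Qed.

Lemma test_function_L2 phi : test_function phi -> L2 phi.
Proof.
move=> tp; have [M hM] := test_function_box tp.
have cr := smooth_continuous (Re_smooth tp); have ci := smooth_continuous (Im_smooth tp).
apply/L2P; split; try exact: continuous_measurable_plane.
apply: (@box_support_integrable _ M).
  by move=> x; apply: cvgD; apply: cvgM; (try exact: cr); exact: ci.
by move=> x /hM; rewrite /rdot => ->; rewrite mulr0 addr0.
Qed.

Lemma test_functionD phi psi : test_function phi -> test_function psi ->
  test_function (fun x => phi x + psi x).
Proof.
move=> t1 t2; split.
- rewrite (_ : (fun x => _) = (fun x => Re (phi x) + Re (psi x))).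
    by apply: smoothD; exact: Re_smooth.
  by apply/funext => x; rewrite ReD.
- rewrite (_ : (fun x => _) = (fun x => Im (phi x) + Im (psi x))).
    by apply: smoothD; exact: Im_smooth.
  by apply/funext => x; rewrite ImD.
have [_ _ c1] := t1; have [_ _ c2] := t2.
apply: (@compact_supp (supp phi `|` supp psi)); first exact: compactU.
  by apply: closedU; exact: closed_closure.
by move=> x /not_orP[n1 n2]; rewrite (supp_eq0 n1) (supp_eq0 n2) addr0.
Qed.

Lemma test_functionZ (c : R) phi : test_function phi ->
  test_function (c *: (phi : R * R -> Rcomplex R)).
Proof.
move=> t1; split.
- rewrite (_ : (fun x => _) = (fun x => c * Re (phi x))).
    by apply: smoothZ; exact: Re_smooth.
  by apply/funext => x; rewrite -ReZ.
- rewrite (_ : (fun x => _) = (fun x => c * Im (phi x))).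
    by apply: smoothZ; exact: Im_smooth.
  by apply/funext => x; rewrite -ImZ.
have [_ _ c1] := t1; apply: (compact_supp c1); first exact: closed_closure.
move=> x n1; rewrite -[LHS]/(c *: (phi x : Rcomplex R)) (supp_eq0 n1).
by apply: complex_ext; rewrite ?ReZ ?ImZ /= mulr0.
Qed.

Definition mulI phi : R * R -> R[i] := fun x => (0 +i* 1)%C * phi x.

Lemma mulI_Re phi x : Re (mulI phi x) = - Im (phi x).
Proof. by rewrite /mulI; case: (phi x) => a b /=; rewrite mul0r mul1r sub0r. Qed.
Lemma mulI_Im phi x : Im (mulI phi x) = Re (phi x).
Proof. by rewrite /mulI; case: (phi x) => a b /=; rewrite mul0r mul1r add0r. Qed.

Lemma test_functionI phi : test_function phi -> test_function (mulI phi).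
Proof.
move=> t1; split.
- rewrite (_ : (fun x => _) = (fun x => -1 * Im (phi x))).
    by apply: smoothZ; exact: Im_smooth.
  by apply/funext => x; rewrite mulI_Re mulN1r.
- rewrite (_ : (fun x => _) = (fun x => Re (phi x))); first exact: Re_smooth.
  by apply/funext => x; rewrite mulI_Im.
have [_ _ c1] := t1; apply: (compact_supp c1); first exact: closed_closure.
by move=> x n1; rewrite /mulI (supp_eq0 n1) mulr0.
Qed.

(** Components of the vector potential in symmetric gauge: both magnetic derivatives become i times
    a partial derivative plus [gauge]. *)
Definition gauge B j (x : R * R) : R := if j == 0 then - (B / 2) * coord 1 x else B / 2 * coord 0 x.

Lemma mder_Re B j phi x :
  Re (mder B j phi x) = - partial j (ImF phi) x + gauge B j x * Re (phi x).
Proof.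
rewrite /mder /gauge /partialC /coord /=; case: (phi x) => a b; case: ifP => _ /=;
  ring.
Qed.

Lemma mder_Im B j phi x :
  Im (mder B j phi x) = partial j (ReF phi) x + gauge B j x * Im (phi x).
Proof.
rewrite /mder /gauge /partialC /coord /=; case: (phi x) => a b; case: ifP => _ /=;
  ring.
Qed.

Lemma smooth_gaugeM B j (u : R * R -> R) : smooth u -> smooth (fun x => gauge B j x * u x).
Proof.
move=> su; have [->|->] := I2P j.
  rewrite (_ : (fun x => _) = (fun x => - (B / 2) * (coord 1 x * u x))).
    exact/smoothZ/smooth_coordM.
  by apply/funext => x; rewrite mulrA.
rewrite (_ : (fun x => _) = (fun x => B / 2 * (coord 0 x * u x))).
  exact/smoothZ/smooth_coordM.
by apply/funext => x; rewrite mulrA.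
Qed.

Lemma partial_gaugeM B j k (u : R * R -> R) x : smooth u ->
  partial k (fun x => gauge B j x * u x) x =
  gauge B j x * partial k u x +
    (if j == k then 0 else if j == 0 then - (B / 2) else B / 2) * u x.
Proof.
move=> su; have du y := smooth_differentiable y su.
have dg y : differentiable (gauge B j) y.
  have [->|->] := I2P j; rewrite /gauge /=; apply: differentiableZ; exact: differentiable_coord.
rewrite partialM //; congr (_ + _); rewrite mulrC; congr (_ * _).
have [->|->] := I2P j; rewrite /gauge /=.
  rewrite partialZ ?partial_coord; last exact: differentiable_coord.
  by have [->|->] := I2P k; rewrite ?mulr0 ?mulr1.
rewrite partialZ ?partial_coord; last exact: differentiable_coord.
by have [->|->] := I2P k; rewrite ?mulr0 ?mulr1.
Qed.

Lemma test_function_mder B j phi : test_function phi -> test_function (mder B j phi).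
Proof.
move=> t1; have sr := Re_smooth t1; have si := Im_smooth t1; split.
- rewrite (_ : (fun x => _) = (fun x => -1 * partial j (ImF phi) x + gauge B j x * Re (phi x))).
    by apply: smoothD; [apply/smoothZ/smooth_partial|exact: smooth_gaugeM].
  by apply/funext => x; rewrite mder_Re mulN1r.
- rewrite (_ : (fun x => _) = (fun x => partial j (ReF phi) x + gauge B j x * Im (phi x))).
    by apply: smoothD; [apply/smooth_partial|exact: smooth_gaugeM].
  by apply/funext => x; rewrite mder_Im.
have [_ _ c1] := t1; apply: (compact_supp c1); first exact: closed_closure.
move=> x n1; apply/eqP; rewrite eq_complex; apply/andP; split; apply/eqP => /=.
  by rewrite mder_Re (supp_eq0 n1) (@partial_supp _ Im) // mulr0 oppr0 addr0.
by rewrite mder_Im (supp_eq0 n1) (@partial_supp _ Re) // mulr0 addr0.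
Qed.

Lemma mderD B j phi psi : test_function phi -> test_function psi ->
  mder B j (fun x => phi x + psi x) = (fun x => mder B j phi x + mder B j psi x).
Proof.
move=> t1 t2; apply/funext => x; apply: complex_ext.
  rewrite ReD !mder_Re ReD.
  rewrite (_ : ImF (fun y => phi y + psi y) = (fun y => Im (phi y) + Im (psi y))); last first.
    by apply/funext => y; rewrite ImD.
  by rewrite partialD; [ring|exact/smooth_differentiable/Im_smooth|exact/smooth_differentiable/Im_smooth].
rewrite ImD !mder_Im ImD.
rewrite (_ : ReF (fun y => phi y + psi y) = (fun y => Re (phi y) + Re (psi y))); last first.
  by apply/funext => y; rewrite ReD.
by rewrite partialD; [ring|exact/smooth_differentiable/Re_smooth|exact/smooth_differentiable/Re_smooth].
Qed.

Lemma mderZ B j (c : R) phi : test_function phi ->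
  mder B j (c *: (phi : R * R -> Rcomplex R)) = c *: (mder B j phi : R * R -> Rcomplex R).
Proof.
move=> t1; apply/funext => x; rewrite -[RHS]/(c *: (mder B j phi x : Rcomplex R)).
apply: complex_ext.
  rewrite ReZ !mder_Re -[(c *: _) x]/(c *: (phi x : Rcomplex R)) ReZ.
  rewrite (_ : ImF (c *: (phi : R * R -> Rcomplex R)) = (fun y => c * Im (phi y))); last first.
    by apply/funext => y; rewrite -ImZ.
  by rewrite partialZ; [ring|exact/smooth_differentiable/Im_smooth].
rewrite ImZ !mder_Im -[(c *: _) x]/(c *: (phi x : Rcomplex R)) ImZ.
rewrite (_ : ReF (c *: (phi : R * R -> Rcomplex R)) = (fun y => c * Re (phi y))); last first.
    by apply/funext => y; rewrite -ReZ.
by rewrite partialZ; [ring|exact/smooth_differentiable/Re_smooth].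
Qed.

Lemma partialN j (u : R * R -> R) x : smooth u -> partial j (fun y => - u y) x = - partial j u x.
Proof.
move=> su; rewrite -mulN1r -partialZ; last exact: smooth_differentiable.
by congr (partial j _ x); apply/funext => y; rewrite mulN1r.
Qed.

Lemma mderI B j phi : test_function phi -> mder B j (mulI phi) = mulI (mder B j phi).
Proof.
move=> t1; apply/funext => x; apply: complex_ext.
  rewrite mulI_Re mder_Re mder_Im mulI_Re.
  rewrite (_ : ImF (mulI phi) = ReF phi); last by apply/funext => y; rewrite mulI_Im.
  by ring.
rewrite mulI_Im mder_Im mder_Re mulI_Im.
rewrite (_ : ReF (mulI phi) = (fun y => - Im (phi y))); last by apply/funext => y; rewrite mulI_Re.
by rewrite partialN //; exact: Im_smooth.
Qed.

(** Second-order terms cancel by [partial_comm]; differentiating the potentials yields i B / 2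
    twice. *)
Lemma mder_comm B phi x : test_function phi ->
  mder B 0 (mder B 1 phi) x = mder B 1 (mder B 0 phi) x + B%:C%C * mulI phi x.
Proof.
move=> t1; have sr := Re_smooth t1; have si := Im_smooth t1.
have ReE j : ReF (mder B j phi) = (fun y => - partial j (ImF phi) y + gauge B j y * Re (phi y)).
  by apply/funext => y; rewrite mder_Re.
have ImE j : ImF (mder B j phi) = (fun y => partial j (ReF phi) y + gauge B j y * Im (phi y)).
  by apply/funext => y; rewrite mder_Im.
have pRe k j : partial k (ReF (mder B j phi)) x = - partial k (partial j (ImF phi)) x +
    partial k (fun y => gauge B j y * Re (phi y)) x.
  rewrite ReE partialD; first 1 last.
  - by apply: differentiableN; exact/smooth_differentiable/smooth_partial.
  - exact/smooth_differentiable/smooth_gaugeM.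
  by rewrite partialN //; exact: smooth_partial.
have pIm k j : partial k (ImF (mder B j phi)) x = partial k (partial j (ReF phi)) x +
    partial k (fun y => gauge B j y * Im (phi y)) x.
  rewrite ImE partialD //; first exact/smooth_differentiable/smooth_partial.
  exact/smooth_differentiable/smooth_gaugeM.
have BRe (z : R[i]) : Re (B%:C%C * z) = B * Re z by case: z => a b /=; ring.
have BIm (z : R[i]) : Im (B%:C%C * z) = B * Im z by case: z => a b /=; ring.
have g10 u : smooth u ->
    partial 0 (fun y => gauge B 1 y * u y) x = gauge B 1 x * partial 0 u x + B / 2 * u x.
  by move=> su; rewrite (partial_gaugeM B 1 0 x su).
have g01 u : smooth u ->
    partial 1 (fun y => gauge B 0 y * u y) x = gauge B 0 x * partial 1 u x + - (B / 2) * u x.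
  by move=> su; rewrite (partial_gaugeM B 0 1 x su).
have ext (z a b : R[i]) : Re z = Re a + Re b -> Im z = Im a + Im b -> z = a + b.
  by move=> er ei; apply: complex_ext; rewrite ?ReD ?ImD.
(* Stated over variables: comparing terms that differ in the indices 0 and 1
   of 'I_2 makes conversion unfold the derivatives. *)
have idRe (p q g0 g1 a b d : R) :
    - (d + (g1 * a + B / 2 * q)) + g0 * (- b + g1 * p) =
    (- (d + (g0 * b + - (B / 2) * q)) + g1 * (- a + g0 * p)) + B * - q by field.
have idIm (p q g0 g1 a b d : R) :
    (- d + (g1 * a + B / 2 * p)) + g0 * (b + g1 * q) =
    (- d + (g0 * b + - (B / 2) * p)) + g1 * (a + g0 * q) + B * p by field.
have eRe i k : Re (mder B i (mder B k phi) x) =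
    - (partial i (partial k (ReF phi)) x + partial i (fun y => gauge B k y * Im (phi y)) x) +
    gauge B i x * (- partial k (ImF phi) x + gauge B k x * Re (phi x)).
  by rewrite mder_Re pIm mder_Re.
have eIm i k : Im (mder B i (mder B k phi) x) =
    (- partial i (partial k (ImF phi)) x + partial i (fun y => gauge B k y * Re (phi y)) x) +
    gauge B i x * (partial k (ReF phi) x + gauge B k x * Im (phi x)).
  by rewrite mder_Im pRe mder_Im.
have e0 := eRe 0 1; have e1 := eRe 1 0; have e2 := eIm 0 1; have e3 := eIm 1 0.
rewrite (g10 _ si) (partial_comm x sr) in e0; rewrite (g01 _ si) in e1.
rewrite (g10 _ sr) (partial_comm x si) in e2; rewrite (g01 _ sr) in e3.
apply: ext.
  apply: (etrans e0); apply: esym.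
  apply: (etrans (congr2 +%R e1 (etrans (BRe _) (congr1 ( *%R B) (mulI_Re phi x))))).
  exact: (esym (idRe (Re (phi x)) (Im (phi x)) (gauge B 0 x) (gauge B 1 x)
    (partial 0 (ImF phi) x) (partial 1 (ImF phi) x) (partial 1 (partial 0 (ReF phi)) x))).
apply: (etrans e2); apply: esym.
apply: (etrans (congr2 +%R e3 (etrans (BIm _) (congr1 ( *%R B) (mulI_Im phi x))))).
exact: (esym (idIm (Re (phi x)) (Im (phi x)) (gauge B 0 x) (gauge B 1 x)
  (partial 0 (ReF phi) x) (partial 1 (ReF phi) x) (partial 1 (partial 0 (ImF phi)) x))).
Qed.

(** The potential terms cancel, and the integrands differ by the partial derivative of w = - Im (phi
    conj(psi)), which is compactly supported and integrates to zero. *)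
Lemma mder_sym B j phi psi : test_function phi -> test_function psi ->
  L2ip (mder B j phi) psi = L2ip phi (mder B j psi).
Proof.
move=> t1 t2; apply/eqP; rewrite -subr_eq0; apply/eqP.
have s1 := Re_smooth t1; have s2 := Im_smooth t1.
have s3 := Re_smooth t2; have s4 := Im_smooth t2.
have [M hM] := test_function_box t1.
have dM (u v : R * R -> R) x : smooth u -> smooth v -> differentiable (fun y => u y * v y) x.
  by move=> su sv; apply: differentiableM; exact: smooth_differentiable.
pose w (x : R * R) := Re (phi x) * Im (psi x) + -1 * (Im (phi x) * Re (psi x)).
have dw x : differentiable w x.
  by apply: differentiableD; [exact: dM|apply: differentiableZ; exact: dM].
have pw : partial j w = (fun x =>
    (Re (phi x) * partial j (ImF psi) x + Im (psi x) * partial j (ReF phi) x) -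
    (Im (phi x) * partial j (ReF psi) x + Re (psi x) * partial j (ImF phi) x)).
  apply/funext => x; rewrite partialD; [|exact: dM|by apply: differentiableZ; exact: dM].
  rewrite partialZ; last exact: dM.
  by rewrite !partialM ?mulN1r //; exact: smooth_differentiable.
have cM (u v : R * R -> R) : smooth u -> smooth v -> continuous (fun y => u y * partial j v y).
  move=> su sv x; apply: cvgM; first exact: smooth_continuous.
  by apply: smooth_continuous; exact: smooth_partial.
have cw : continuous (partial j w).
  by rewrite pw => x; apply: cvgB; apply: cvgD; exact: cM.
have bw : box_support M w.
  by move=> x /hM; rewrite /w => ->; rewrite !mul0r mulr0 addr0.
have L1 := test_function_L2 t1; have L2' := test_function_L2 t2.
have L3 := test_function_L2 (test_function_mder B j t1).
have L4 := test_function_L2 (test_function_mder B j t2).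
rewrite /L2ip -RintegralB //; [|exact: integrable_rdot|exact: integrable_rdot].
apply: (@etrans _ _ (Rintegral leb2 setT (partial j w))); last first.
  by rewrite /Rintegral (integral_partial dw cw bw).
apply: eq_Rintegral => x _; apply: (etrans _ (esym (congr1 (fun h => h x) pw))).
by rewrite /rdot !mder_Re !mder_Im; ring.
Qed.

End TestFunctions.

(** * The Landau operator on L^2 as an instance of the abstract setting *)

Section Assembly.
Context {R : realType}.
Local Notation Re := (@complex.Re R).
Local Notation Im := (@complex.Im R).
Local Notation V := (@L2fun R).
Local Notation line := (measurableTypeR R).

Definition tstL2 (u : V) : Prop := test_function (u : R * R -> R[i]).
Definition derL2 (B : R) (j : 'I_2) (u : V) : V := mkL2 (mder B j u).
Definition JL2 (u : V) : V := mkL2 (mulI u).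

Lemma L2_mulI (f : R * R -> R[i]) : L2 f -> L2 (mulI f).
Proof.
move=> /L2P[mr mi If]; apply/L2P; split.
- rewrite (_ : (fun _ => _) = (fun x => - Im (f x))); last first.
    by apply/funext => x; rewrite mulI_Re.
  exact: measurableT_comp.
- by rewrite (_ : (fun _ => _) = (fun x => Re (f x))) //; apply/funext => x; rewrite mulI_Im.
rewrite (_ : EFin \o _ = EFin \o rdot f f) //.
by apply/funext => x /=; rewrite /rdot mulI_Re mulI_Im; congr (_%:E); ring.
Qed.

Lemma JL2E (u : V) : (JL2 u : R * R -> R[i]) = mulI u.
Proof. exact: mkL2E (L2_mulI (L2funP u)). Qed.

Lemma derL2E B j (u : V) : tstL2 u -> (derL2 B j u : R * R -> R[i]) = mder B j u.
Proof. by move=> tu; exact: mkL2E (test_function_L2 (test_function_mder B j tu)). Qed.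

Lemma L2_test_space : test_space (@ipL2 R) JL2 tstL2.
Proof.
split.
- move=> u v; apply: L2fun_eq; rewrite JL2E; apply/funext => x.
  rewrite -[RHS]/(JL2 u x + JL2 v x) !JL2E.
  by rewrite /mulI -[(u + v : V) x]/(u x + v x) mulrDr.
- move=> c u; apply: L2fun_eq; rewrite JL2E; apply/funext => x.
  rewrite -[RHS]/(c *: (JL2 u x : Rcomplex R)) !JL2E.
  apply: complex_ext; rewrite ?ReZ ?ImZ ?mulI_Re ?mulI_Im -[(c *: u : V) x]/(c *: (u x : Rcomplex R)).
    by rewrite ImZ mulrN.
  by rewrite ReZ.
- move=> u; apply: L2fun_eq; rewrite !JL2E; apply/funext => x.
  rewrite -[RHS]/(- (u x)).
  by apply: complex_ext; rewrite ?ReN ?ImN ?mulI_Re ?mulI_Im ?mulI_Re ?mulI_Im.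
- move=> u v; apply: eq_Rintegral => x _; rewrite /rdot !JL2E !mulI_Re !mulI_Im.
  by ring.
- by move=> u v; exact: test_functionD.
- by move=> c u; exact: test_functionZ.
- by move=> u tu; rewrite /tstL2 JL2E; exact: test_functionI.
Qed.

Lemma derL2_symmetric B j : symmetric_operator (@ipL2 R) JL2 tstL2 (derL2 B j).
Proof.
split.
- by move=> u tu; rewrite /tstL2 derL2E //; exact: test_function_mder.
- move=> u v tu tv; apply: L2fun_eq; rewrite derL2E; last exact: test_functionD.
  rewrite -[RHS]/(fun x => derL2 B j u x + derL2 B j v x) !derL2E //.
  exact: mderD.
- move=> c u tu; apply: L2fun_eq; rewrite derL2E; last exact: test_functionZ.
  rewrite -[RHS]/(c *: (derL2 B j u : R * R -> Rcomplex R)) derL2E //.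
  exact: mderZ.
- move=> u tu; have tJ : tstL2 (JL2 u) by exact: (tstJ L2_test_space).
  apply: L2fun_eq; rewrite derL2E // !JL2E derL2E //.
  exact: mderI.
- by move=> u v tu tv; rewrite /ipL2 !derL2E //; exact: mder_sym.
Qed.

Lemma derL2_comm B u : tstL2 u ->
  derL2 B 0 (derL2 B 1 u) = derL2 B 1 (derL2 B 0 u) + B *: JL2 u.
Proof.
move=> tu; have t0 := tst_op (derL2_symmetric B 0) tu; have t1 := tst_op (derL2_symmetric B 1) tu.
apply: L2fun_eq; rewrite (derL2E B 0 t1) (derL2E B 1 tu); apply/funext => x.
rewrite -[RHS]/(derL2 B 1 (derL2 B 0 u) x + B *: (JL2 u x : Rcomplex R)).
rewrite (derL2E B 1 t0) (derL2E B 0 tu) JL2E mder_comm //; congr (_ + _).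
by case: (mulI _ _) => a b; apply: complex_ext; rewrite ?ReZ ?ImZ /=; ring.
Qed.

Lemma L2norm_ip (u : V) : (L2norm (u : R * R -> R[i]) ^+ 2 = (ipL2 u u)%:E)%E.
Proof. by rewrite L2norm_sqr ipL2_sqr. Qed.

Lemma L2norm_sqrt (u : V) : L2norm (u : R * R -> R[i]) = (Num.sqrt (ipL2 u u))%:E.
Proof.
have [_ _] := L2funP u; have := Lnorm_ge0 leb2 2%:E (fun x => (ComplexField.Normc.normc (u x))%:E).
rewrite -/(L2norm u); have := L2norm_ip u; case: (L2norm u) => [r| |] //.
rewrite -EFin_expe => -[<-]; rewrite lee_fin => r0 _.
by rewrite sqrtr_sqr ger0_norm.
Qed.

Lemma L2cvgP (u : nat -> V) (f : V) :
  L2cvg (fun n => u n : R * R -> R[i]) f <-> vlim (@ipL2 R) u f.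
Proof.
have e : (fun n => L2norm (fun x => u n x - f x)) =
    EFin \o (fun n => Num.sqrt (ipL2 (u n - f) (u n - f))).
  by apply/funext => n /=; rewrite -L2norm_sqrt.
rewrite /L2cvg /vlim e; split=> [/fine_cvgP[_ h]|h].
  have -> : (fun n => ipL2 (u n - f) (u n - f)) =
     (fun n => Num.sqrt (ipL2 (u n - f) (u n - f)) * Num.sqrt (ipL2 (u n - f) (u n - f))).
    by apply/funext => n; rewrite -expr2 sqr_sqrtr // (ip_ge0 (@ipL2_semi_inner R)).
  by rewrite -[X in _ --> X](mulr0 0); apply: cvgM.
apply: cvg_EFin; first exact: nearW.
have := cvg_comp _ _ h (@sqrt_continuous R 0); rewrite sqrtr0.
exact.
Qed.

Local Notation graphL2 B := (landau_graph (@ipL2 R) tstL2 (derL2 B 0) (derL2 B 1)).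

Lemma landau_op_val B (u : V) : tstL2 u ->
  (landau_op (derL2 B 0) (derL2 B 1) u : R * R -> R[i]) = landau_test B u.
Proof.
move=> tu.
have e j x : derL2 B j (derL2 B j u) x = mder B j (mder B j u) x.
  have -> := derL2E B j (tst_op (derL2_symmetric B j) tu).
  by rewrite (derL2E B j tu).
have ee i k x : (derL2 B i (derL2 B i u) + derL2 B k (derL2 B k u) : V) x =
    mder B i (mder B i u) x + mder B k (mder B k u) x.
  by rewrite -(e i x) -(e k x).
by apply/funext => x; exact: ee.
Qed.

Lemma landauP B (f g : V) : landau B f g <-> graphL2 B f g.
Proof.
split=> [[_ _ [phi [tphi pf pg]]]|[phi [tphi pf pg]]].
  have E n : (mkL2 (phi n) : R * R -> R[i]) = phi n by exact: mkL2E (test_function_L2 (tphi n)).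
  exists (fun n => mkL2 (phi n)); split.
  - by move=> n; rewrite /tstL2 E.
  - by apply/L2cvgP; rewrite (_ : (fun n => _) = phi) //; exact/funext.
  - apply/L2cvgP; rewrite (_ : (fun n => _) = (fun n => landau_test B (phi n))) //.
    by apply/funext => n; rewrite landau_op_val ?E // /tstL2 E.
split; [exact: L2funP|exact: L2funP|].
exists (fun n => L2val (phi n)); split => //; first exact/(L2cvgP phi).
rewrite (_ : (fun n => landau_test B (L2val (phi n))) =
  (fun n => L2val (landau_op (derL2 B 0) (derL2 B 1) (phi n)))).
  exact/(L2cvgP (fun n => landau_op (derL2 B 0) (derL2 B 1) (phi n))).
by apply/funext => n; rewrite landau_op_val.
Qed.

Lemma spectral_measure_weak B P : spectral_measure_of (landau B) P ->
  weak_spectral_measure (@ipL2 R) (graphL2 B) (fun S u => mkL2 (P S u)).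
Proof.
move=> [[proj setT' setI' sa] sp].
have PE S (u : V) : measurable S -> (mkL2 (P S u) : R * R -> R[i]) = P S u.
  by move=> mS; apply: mkL2E; exact: (oproj_L2 (proj S mS) (L2funP u)).
have LP S (u : V) : measurable S -> L2 (P S u).
  by move=> mS; exact: (oproj_L2 (proj S mS) (L2funP u)).
split.
- move=> S u v mS; rewrite /ipL2 !PE // -!inner_Re.
  by rewrite (oproj_sym (proj S mS) (L2funP u) (L2funP v)).
- move=> S1 S2 u v m1 m2; have m12 := measurableI _ _ m1 m2.
  rewrite /ipL2 !PE //; apply: L2ip_ae; try exact: L2funP; try exact: LP.
    by rewrite -(PE S2 u m2); exact: LP.
  exact: (setI' _ _ _ m1 m2 (L2funP u)).
- move=> u v; rewrite /ipL2 PE //; apply: L2ip_ae; try exact: L2funP; try exact: LP.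
  exact/setT'/L2funP.
- move=> u; have [nu hnu] := sa _ (L2funP u); exists nu => S mS.
  by rewrite hnu // inner_Re /ipL2 PE.
move=> u nu hnu.
have hnu' S : measurable S -> nu S = (Re (inner (P S u) u))%:E.
  by move=> mS; rewrite hnu // inner_Re /ipL2 PE.
have [h1 h2] := sp _ nu (L2funP u) hnu'; split.
  rewrite -h1; split=> [[g Tg]|[g Tg]]; first by exists g; exact/landauP.
  have [_ Lg _] := Tg; exists (mkL2 g); apply/landauP; by rewrite mkL2E.
move=> g Tg; rewrite /ipL2 -inner_Re h2 //.
exact/landauP.
Qed.

(** [weak_spectral_selfadjoint] asks for the pairing with every element of the graph; each is a
    limit of test functions, where the hypothesis applies. *)
Lemma landau_selfadjoint B P : spectral_measure_of (landau B) P ->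
  selfadjoint_graph (@ipL2 R) tstL2 (derL2 B 0) (derL2 B 1).
Proof.
move=> sp f g fg.
have hip := @ipL2_semi_inner R.
have hT := landau_graph_sym hip L2_test_space (derL2_symmetric B 0) (derL2_symmetric B 1).
have cT := @landau_graph_closed _ _ _ hip tstL2 (derL2 B 0) (derL2 B 1).
apply: (weak_spectral_selfadjoint hip hT cT (spectral_measure_weak sp)).
move=> u v [phi [tphi pu pv]].
have h1 := ip_vlim hip (w := f) pv; have h2 := ip_vlim hip (w := g) pu.
rewrite (ipC hip f) (ipC hip g); apply: (cvg_unique _ h1) => //.
rewrite (_ : (fun n => _) = (fun n => ipL2 (phi n) g)) //.
by apply/funext => n; rewrite (ipC hip) fg // (ipC hip).
Qed.

(** Im <f, g> = Re <f, i g>: complex weak identities follow from real ones tested against psi and i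
    psi. *)
Lemma inner_Im (f g : R * R -> R[i]) : Im (inner f g) = L2ip f (mulI g).
Proof.
apply: eq_Rintegral => x _; rewrite /rdot mulI_Re mulI_Im.
by case: (f x) (g x) => [a b] [c d] /=; ring.
Qed.

Lemma test_function_word B s (phi : R * R -> R[i]) : test_function phi -> test_function (mder_word B s phi).
Proof. by move=> tp; elim: s => //= j s IH; exact: test_function_mder. Qed.

Lemma mder_word_mulI B s (phi : R * R -> R[i]) : test_function phi ->
  mder_word B s (mulI phi) = mulI (mder_word B s phi).
Proof.
move=> tp; elim: s => //= j s ->; rewrite mderI //.
exact: test_function_word.
Qed.

Lemma word_op_val B s (phi : R * R -> R[i]) : test_function phi ->
  (word_op (derL2 B 0) (derL2 B 1) s (mkL2 phi) : R * R -> R[i]) = mder_word B s phi.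
Proof.
move=> tp; have E := mkL2E (test_function_L2 tp).
have tE : tstL2 (mkL2 phi) by rewrite /tstL2 E.
elim: s => //= j s IH.
have tw : tstL2 (word_op (derL2 B 0) (derL2 B 1) s (mkL2 phi)).
  by rewrite /tstL2 IH; exact: test_function_word.
have [->|->] := I2P j => /=; rewrite derL2E // IH //.
Qed.

End Assembly.

Theorem theorem8 (R : realType) (E B : R) (m : nat) (f : R * R -> R[i])
    (hE : 0 <= E) (hB : 0 <= B)
    (hf : ran_spectral_projector (landau B) [set` `]-oo, E]] f) :
  exists g : m.-tuple 'I_2 -> R * R -> R[i],
    (forall a, L2 (g a) /\ weak_mder_word B a f (g a)) /\
    (\sum_(a : m.-tuple 'I_2) L2norm (g a) ^+ 2
       <= ((E + B * m%:R) ^+ m)%:E * L2norm f ^+ 2)%E.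
Proof.
have [P [sp [Lf [h [Lh fh]]]]] := hf.
have hip := @ipL2_semi_inner R.
have hP := spectral_measure_weak sp.
have sa := landau_selfadjoint sp.
have cpl := @ipL2_complete R.
have hT := landau_graph_sym hip L2_test_space (derL2_symmetric B 0) (derL2_symmetric B 1).
have fE := mkL2E Lf; have hE' := mkL2E Lh.
have mS : measurable ([set` `]-oo, E]] : set (measurableTypeR R)) by exact: measurable_itv.
(* f equals a projected function only almost everywhere, hence the passage through
   [spectral_range_eq]. *)
have rf : spectral_range (@ipL2 R) (fun S u => mkL2 (P S u)) [set` `]-oo, E]] (mkL2 f).
  have fa v : ipL2 (mkL2 f) v = ipL2 (mkL2 (P [set` `]-oo, E]] (mkL2 h))) v.
    have LP : L2 (P [set` `]-oo, E]] h) by exact: (oproj_L2 (pvm_proj sp.1 mS) Lh).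
    by rewrite /ipL2 fE hE' (mkL2E LP); apply: L2ip_ae => //; exact: L2funP.
  exact: (spectral_range_eq hP mS fa (spectral_range_proj hP _ mS)).
have pos u g : landau_graph (@ipL2 R) (@tstL2 R) (derL2 B 0) (derL2 B 1) u g -> 0 <= ipL2 g u.
  move=> Tug; apply: le_trans (landau_lower hip L2_test_space (derL2_symmetric B 0)
    (derL2_symmetric B 1) (@derL2_comm R B) cpl Tug).
  by rewrite mulr_ge0 // (ip_ge0 hip).
have bl := spectral_range_bandlimited hip hT hP pos hE rf.
have [g [wg sg]] := bandlimited_bernstein hip L2_test_space (derL2_symmetric B 0) (derL2_symmetric B 1)
   (@derL2_comm R B) hB cpl sa m hE bl.
exists (fun a => L2val (g a)); split.
  move=> a; split; first exact: L2funP.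
  have re psi : test_function psi -> L2ip (g a) psi = L2ip f (mder_word B (rev a) psi).
    move=> tpsi; have := wg a (mkL2 psi); rewrite /tstL2 /ipL2.
    by rewrite word_op_val // (mkL2E (test_function_L2 tpsi)) fE; exact.
  (* The imaginary part is the real identity at [mulI phi], because magnetic derivatives commute
     with i. *)
  move=> phi tphi; apply: complex_ext; first by rewrite !inner_Re re.
  by rewrite !inner_Im re ?mder_word_mulI //; exact: test_functionI.
rewrite (eq_bigr (fun a => (ipL2 (g a) (g a))%:E)) => [|a _]; last exact: L2norm_ip.
have -> : L2norm f = L2norm (mkL2 f : R * R -> R[i]) by rewrite fE.
by rewrite sumEFin L2norm_ip -EFinM lee_fin.
Qed.
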